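(* Let $p\in C_{\mathrm b}^{1,\infty}([0,T]\times\mathbb R^d;\mathbb R)$ be the solution to the Fokker–Planck equation $$p(t)=q_0+\int_0^tA^*p(s)\,\mathrm ds,\quad t\in[0,T],$$ and let $\overline\pi_n\in C_{\mathrm b}^\infty(\mathbb R^d;\mathbb R)$, $n=0,\dots,N$, be defined by $\overline\pi_0=q_0$ and the minimization problems $$(\overline\pi_{n+1}(x))_{x\in\mathbb R^d}=\mathop{\mathrm{arg\,min}}_{u\in C(\mathbb R^d;\mathbb R)}\mathbb E\Big[\big|u(Z_{N-(n+1)})-(G_b\overline\pi_n)(Z_{N-n})\big|^2\Big],\quad n=0,\dots,N-1,$$ where $Z_n$, $n=0,\dots,N$, is the Euler–Maruyama approximation $$Z_{n+1}=Z_n+b(Z_n)(t_{n+1}-t_n)+\sigma(Z_n)(W_{t_{n+1}}-W_{t_n}),\quad n=0,\dots,N-1,$$ with $Z_0\sim\widetilde q_0$. Suppose that $b$ is given by $b_i=-\mu_i+\sum_{j=1}^d\frac{\partial a_{ij}}{\partial x_j}$, $i=1,\dots,d$. Then there exists a constant $C=C(T,\mu,\sigma)>0$ (independent of $N$) such that, whenever $\tau:=\frac TN\le1$, $$\sup_{n=0,\dots,N}\|p(t_n)-\overline\pi_n\|_{L^\infty(\mathbb R^d;\mathbb R)}\le C\tau.$$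
   Context: Setting. $T>0$, $d\ge1$ and $N\ge1$ are given; $\tau=T/N$ and $t_n=n\tau$, $n=0,\dots,N$. $W$ is a $d$-dimensional Brownian motion on a filtered probability space, and $\widetilde q_0$ is a probability density on $\mathbb R^d$ with finite moments. $C_{\mathrm b}^\infty$ denotes infinitely differentiable functions that are bounded together with all their derivatives; $C_{\mathrm b}^{1,\infty}([0,T]\times\mathbb R^d;\mathbb R)$ denotes functions once continuously differentiable in the first variable and infinitely differentiable in the second (no cross derivatives required), bounded together with these derivatives. Standing assumptions. (i) $\mu\in C_{\mathrm b}^\infty(\mathbb R^d;\mathbb R^d)$, $\sigma\in C_{\mathrm b}^\infty(\mathbb R^d;\mathbb R^{d\times d})$, and the initial probability density $q_0\in C_{\mathrm b}^\infty(\mathbb R^d;\mathbb R)$. (ii) Parabolic Hörmander condition: let $V_i=\sigma_i$ ($i$-th column of $\sigma$), $i=1,\dots,d$, and $V_0=\mu+\frac12\sum_{j=1}^d \mathrm DV_j\,V_j$, where $\mathrm DV$ is the Jacobi matrix; with $[V,W]=\mathrm DW\,V-\mathrm DV\,W$, for every $x\in\mathbb R^d$ the vectors $V_{j_0}(x)$, $[V_{j_1},V_{j_2}](x)$, $[[V_{j_1},V_{j_2}],V_{j_3}](x),\dots$ with $j_0\in\{1,\dots,d\}$ and $j_i\in\{0,\dots,d\}$ for $i\ge1$ span $\mathbb R^d$. Operators. $a:=\sigma\sigma^\top$; $A^*\varphi=\frac12\sum_{i,j}\frac{\partial^2}{\partial x_i\partial x_j}(a_{ij}\varphi)-\sum_i\frac{\partial}{\partial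 x_i}(\mu_i\varphi)$; $$F_b\varphi=\sum_{i}\Big(\sum_j\frac{\partial a_{ij}}{\partial x_j}\Big)\frac{\partial\varphi}{\partial x_i}+\frac12\sum_{i,j}\frac{\partial^2a_{ij}}{\partial x_i\partial x_j}\varphi-\sum_i\frac{\partial\mu_i}{\partial x_i}\varphi-\sum_i\mu_i\frac{\partial\varphi}{\partial x_i}-\sum_i b_i\frac{\partial\varphi}{\partial x_i};$$ $G_b\varphi:=\varphi+\tau F_b\varphi$.
   Formalization: The constant C may also depend on the initial density q_0, not only on T, mu, sigma; a constant uniform over all q_0 is impossible (d=1, sigma=1, mu=sin, q_0 near a Dirac mass at 0 gives an error of order tau^{1/2} at n=1). *)

(* Defs.v *)
From HB Require Import structures.
From mathcomp Require Import all_boot all_order all_algebra.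
From mathcomp Require Import all_classical all_reals all_analysis.

Set Implicit Arguments.
Unset Strict Implicit.
Unset Printing Implicit Defensive.

Import Order.TTheory GRing.Theory Num.Theory.
Import numFieldNormedType.Exports.

Local Open Scope classical_set_scope.
Local Open Scope ring_scope.

(* Points of R^d are column vectors 'cV[R]_d, with the library's topology and
   max norm. *)

(* The Borel sigma-algebra of R^d, generated by the coordinate maps as the
   library does for n.-tuple. *)
Section borel_cV.
Context {R : realType} (n : nat).

Let coord (i : 'I_n) (x : 'cV[R]_n) : R := x i 0.

Let cV_set0 : g_sigma_preimage coord set0.
Proof. exact: sigma_algebra0. Qed.

Let cV_setC A : g_sigma_preimage coord A -> g_sigma_preimage coord (~` A).
Proof. exact: sigma_algebraC. Qed.

Let cV_bigcup (F : (set 'cV[R]_n)^nat) :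
  (forall i, g_sigma_preimage coord (F i)) ->
  g_sigma_preimage coord (\bigcup_i (F i)).
Proof. exact: sigma_algebra_bigcup. Qed.

HB.instance Definition _ := @isMeasurable.Build default_measure_display
  'cV[R]_n (g_sigma_preimage coord) cV_set0 cV_setC cV_bigcup.

Lemma measurable_coord (i : 'I_n) :
  measurable_fun [set: 'cV[R]_n] (fun x : 'cV[R]_n => x i 0 : R).
Proof.
move=> _ Y mY; rewrite setTI; apply: sub_sigma_algebra => /=.
rewrite -bigcup_seq/=; exists i => /=; first by rewrite mem_index_enum.
by exists Y => //; rewrite setTI.
Qed.

Lemma measurable_fun_coordP d (T : measurableType d) (f : T -> 'cV[R]_n) :
  (forall i, measurable_fun [set: T] (fun x => f x i 0 : R)) ->
  measurable_fun [set: T] f.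
Proof.
move=> mf; have sub : g_sigma_preimage (fun i => coord i \o f) `<=` measurable.
  apply: smallest_sub; first exact: sigma_algebra_measurable.
  elim/big_ind : _ => //; first by move=> A B ? ?; rewrite subUset.
  by move=> i _ A [B mB <-]; exact: mf.
move=> _ A mA; apply: sub; rewrite g_sigma_preimage_comp.
by exists A.
Qed.

End borel_cV.

Section product_step.
Context {R : realType} (n : nat).

Definition cons_cV (z : measurableTypeR R * 'cV[R]_n) : 'cV[R]_n.+1 :=
  col_mx (z.1%:M : 'cV[R]_1) z.2.

Definition uncons_cV (x : 'cV[R]_n.+1) :
    measurableTypeR R * 'cV[R]_n :=
  (x 0 0, dsubmx (x : 'cV[R]_(1 + n))).

Lemma cons_cVK : cancel cons_cV uncons_cV.
Proof.
case=> a v; rewrite /uncons_cV /cons_cV /= col_mxKd; congr pair.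
by rewrite mxE; case: splitP => [j _|j //]; rewrite mxE !ord1 eqxx mulr1n.
Qed.

Lemma measurable_cons_cV : measurable_fun [set: measurableTypeR R * 'cV[R]_n] cons_cV.
Proof.
apply: measurable_fun_coordP => i.
have [j ->|j ->] := split_ordP (i : 'I_(1 + n)).
  rewrite (_ : (fun _ => _) = fst) ?measurable_fst//.
  apply/funext => z; apply: etrans (col_mxEu (z.1%:M : 'cV[R]_1) z.2 j 0) _.
  by rewrite mxE !ord1 eqxx mulr1n.
rewrite (_ : (fun _ => _) = (fun x : 'cV[R]_n => x j 0) \o snd); last first.
  by apply/funext => z; exact: (col_mxEd (z.1%:M : 'cV[R]_1)).
exact: measurableT_comp (measurable_coord j) measurable_snd.
Qed.

Lemma measurable_uncons_cV : measurable_fun [set: 'cV[R]_n.+1] uncons_cV.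
Proof.
apply/measurable_fun_pair; first exact: measurable_coord.
apply: measurable_fun_coordP => i.
rewrite (_ : (fun _ => _) = (fun x : 'cV[R]_n.+1 => x (rshift 1 i) 0)).
  exact: measurable_coord.
by apply/funext => x; rewrite mxE.
Qed.

Variables (m1 : {sigma_finite_measure set (measurableTypeR R) -> \bar R})
  (m2 : {sigma_finite_measure set 'cV[R]_n -> \bar R}).

Definition cons_measure : set 'cV[R]_n.+1 -> \bar R :=
  pushforward (m1 \x m2)%E cons_cV.

Let cons_measure0 : cons_measure set0 = 0%E.
Proof. by rewrite /cons_measure /pushforward preimage_set0 measure0. Qed.

Let cons_measure_ge0 A : (0 <= cons_measure A)%E.
Proof. exact: (measure_ge0 (m1 \x m2)%E). Qed.

Let cons_measure_sigma_additive : semi_sigma_additive cons_measure.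
Proof.
move=> F mF tF mUF; rewrite /cons_measure /pushforward preimage_bigcup.
apply: measure_semi_sigma_additive.
- by move=> k; rewrite -[X in measurable X]setTI; exact: measurable_cons_cV.
- apply/trivIsetP => /= i j _ _ ij; rewrite -preimage_setI.
  by move/trivIsetP : tF => /(_ _ _ _ _ ij) ->//; rewrite preimage_set0.
- rewrite -preimage_bigcup -[X in measurable X]setTI.
  exact: measurable_cons_cV.
Qed.

HB.instance Definition _ := isMeasure.Build _ _ _ cons_measure
  cons_measure0 cons_measure_ge0 cons_measure_sigma_additive.

Let cons_measure_sigma_finite : sigma_finite [set: 'cV[R]_n.+1] cons_measure.
Proof.
have /sigma_finiteP[F [TF ndF Foo]] := sigma_finiteT m1.
have /sigma_finiteP[G [TG ndG Goo]] := sigma_finiteT m2.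
exists (fun k => uncons_cV @^-1` (F k `*` G k)).
  rewrite -preimage_bigcup (_ : \bigcup_k _ = setT) ?preimage_setT//.
  rewrite -subTset => -[x y] _.
  have [i _ Fix] : (\bigcup_i F i) x by rewrite -TF.
  have [j _ Gjy] : (\bigcup_i G i) y by rewrite -TG.
  exists (maxn i j) => //; split.
  - by move: x Fix; exact/subsetPset/ndF/leq_maxl.
  - by move: y Gjy; exact/subsetPset/ndG/leq_maxr.
move=> k; have [mF Fk] := Foo k; have [mG Gk] := Goo k; split.
  rewrite -[X in measurable X]setTI; apply: measurable_uncons_cV => //.
  exact: measurableX.
rewrite /cons_measure /pushforward -comp_preimage.
rewrite (_ : uncons_cV \o cons_cV = id) ?preimage_id; last first.
  by apply/funext => z; exact: cons_cVK.
by rewrite product_measure1E// lte_mul_pinfty// ge0_fin_numE.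
Qed.

HB.instance Definition _ := Measure_isSigmaFinite.Build _ _ _ cons_measure
  cons_measure_sigma_finite.

End product_step.

Section measure_power.
Context {R : realType}.

(* The n-fold product of m with itself, carried by column vectors. *)
Fixpoint measure_pow (m : {sigma_finite_measure set (measurableTypeR R) -> \bar R}) (n : nat) :
    {sigma_finite_measure set 'cV[R]_n -> \bar R} :=
  match n with
  | 0 => \d_(0 : 'cV[R]_0)
  | n'.+1 => cons_measure m (measure_pow m n')
  end.

Definition lebesgue_cV (n : nat) := measure_pow (@lebesgue_measure R) n.

(* The law N(0, t I_n) for t > 0.  At t = 0 this is not the Dirac mass, since
   [normal_prob 0 0] is by convention the uniform law on [0, 1]. *)
Definition gauss_cV (n : nat) (t : R) :=
  measure_pow (normal_prob 0 (Num.sqrt t)) n.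

End measure_power.

Section smooth_functions.
Context {R : realType} {d : nat}.
Local Notation Rd := 'cV[R]_d.

Definition basis_vec (i : 'I_d) : Rd := delta_mx i 0.

Definition partial (i : 'I_d) (f : Rd -> R) : Rd -> R :=
  fun x => 'D_(basis_vec i) f x.

(* The iterated partial derivative along the word s of coordinate indices;
   the empty word gives the function itself. *)
Definition partials (s : seq 'I_d) (f : Rd -> R) : Rd -> R :=
  foldr partial f s.

Definition Cb_infty (f : Rd -> R) : Prop :=
  forall s : seq 'I_d,
    [/\ forall x i, derivable (partials s f) x (basis_vec i),
        continuous (partials s f) &
        exists M : R, forall x, `|partials s f x| <= M].

Definition Cb_infty_vec (V : Rd -> Rd) : Prop :=
  forall i, Cb_infty (fun x => V x i 0).

Definition Cb_infty_mx (A : Rd -> 'M[R]_d) : Prop :=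
  forall i j, Cb_infty (fun x => A x i j).

(* The time derivative at t in [0, T] is the limit of difference quotients
   over [0, T], hence one-sided at 0 and T. *)
Definition is_time_derivative (T : R) (p q : R -> Rd -> R) : Prop :=
  forall t x, t \in `[0, T] ->
    (fun s => (p s x - p t x) / (s - t)) @ within `[0, T] t^' --> q t x.

Definition cont_bounded_on_strip (T : R) (q : R -> Rd -> R) : Prop :=
  {within `[0, T] `*` [set: Rd],
     continuous (fun z : R * Rd => q z.1 z.2)} /\
  exists M : R, forall t x, t \in `[0, T] -> `|q t x| <= M.

Definition Cb_1_infty (T : R) (p : R -> Rd -> R) : Prop :=
  (exists q, is_time_derivative T p q /\ cont_bounded_on_strip T q) /\
  (forall s : seq 'I_d,
    (forall t x i, t \in `[0, T] -> derivable (partials s (p t)) x (basis_vec i)) /\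
    cont_bounded_on_strip T (fun t => partials s (p t))).

End smooth_functions.

Section vector_fields.
Context {R : realType} {d : nat}.
Local Notation Rd := 'cV[R]_d.

Definition jac (V : Rd -> Rd) (x : Rd) : 'M[R]_d :=
  \matrix_(i, j) partial j (fun y => V y i 0) x.

Definition lie_bracket (V W : Rd -> Rd) : Rd -> Rd :=
  fun x => jac W x *m V x - jac V x *m W x.

(* [None] is the index 0 and [Some j] the index of the j-th column. *)
Definition hfield (mu : Rd -> Rd) (sigma : Rd -> 'M[R]_d)
    (k : option 'I_d) : Rd -> Rd :=
  match k with
  | Some j => fun x => col j (sigma x)
  | None => fun x => mu x +
      2^-1 *: \sum_(j < d)
        jac (fun y => col j (sigma y)) x *m col j (sigma x)
  end.

(* [[...[V_j1, V_j2], ...], V_jm] for js = [:: j2; ...; jm] *)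
Definition iter_bracket (V : option 'I_d -> Rd -> Rd) (j1 : option 'I_d)
    (js : seq (option 'I_d)) : Rd -> Rd :=
  foldl (fun U k => lie_bracket U (V k)) (V j1) js.

Definition hormander_vectors (V : option 'I_d -> Rd -> Rd) (x : Rd) : set Rd :=
  [set v | (exists j : 'I_d, v = V (Some j) x) \/
           (exists j1 j2 js, v = iter_bracket V j1 (j2 :: js) x)].

Definition parabolic_hormander (mu : Rd -> Rd) (sigma : Rd -> 'M[R]_d) : Prop :=
  forall x, exists X : seq Rd,
    (forall v, v \in X -> hormander_vectors (hfield mu sigma) x v) /\
    <<X>>%VS = fullv.

End vector_fields.

Section operators.
Context {R : realType} {d : nat}.
Local Notation Rd := 'cV[R]_d.
Variables (mu : Rd -> Rd) (sigma : Rd -> 'M[R]_d).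

Definition diffusion (x : Rd) : 'M[R]_d := sigma x *m (sigma x)^T.

Local Notation a i j := (fun y : Rd => diffusion y i j).
Local Notation m i := (fun y : Rd => mu y i 0).

Definition Astar (phi : Rd -> R) : Rd -> R := fun x =>
  2^-1 * (\sum_(i < d) \sum_(j < d)
            partial i (partial j (fun y => a i j y * phi y)) x) -
  \sum_(i < d) partial i (fun y => m i y * phi y) x.

Definition F_op (b : Rd -> Rd) (phi : Rd -> R) : Rd -> R := fun x =>
  \sum_(i < d) (\sum_(j < d) partial j (a i j) x) * partial i phi x +
  2^-1 * (\sum_(i < d) \sum_(j < d) partial i (partial j (a i j)) x) * phi x -
  \sum_(i < d) partial i (m i) x * phi x -
  \sum_(i < d) mu x i 0 * partial i phi x -
  \sum_(i < d) b x i 0 * partial i phi x.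

Definition G_op (tau : R) (b : Rd -> Rd) (phi : Rd -> R) : Rd -> R :=
  fun x => phi x + tau * F_op b phi x.

Definition fokker_planck (T : R) (q0 : Rd -> R) (p : R -> Rd -> R) : Prop :=
  forall t x, t \in `[0, T] ->
    p t x = q0 x + \int[lebesgue_measure]_(s in `[0, t]) Astar (p s) x.

End operators.

Section densities.
Context {R : realType} {d : nat}.
Local Notation Rd := 'cV[R]_d.

Definition is_density (q : Rd -> R) : Prop :=
  [/\ measurable_fun [set: Rd] q, forall x, 0 <= q x &
      (\int[lebesgue_cV d]_x (q x)%:E = 1)%E].

Definition finite_moments (q : Rd -> R) : Prop :=
  forall k : nat, (\int[lebesgue_cV d]_x (`|x| ^+ k * q x)%:E < +oo)%E.

End densities.

Section stochastic.
Context {R : realType} {d : nat} {disp : measure_display}.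
Context {Omega : measurableType disp}.
Variable P : probability Omega R.
Local Notation Rd := 'cV[R]_d.

Definition has_density (X : Omega -> Rd) (q : Rd -> R) : Prop :=
  forall B : set Rd, measurable B ->
    P (X @^-1` B) = (\int[lebesgue_cV d]_(x in B) (q x)%:E)%E.

Definition measurable_wrt (G : set (set Omega)) (X : Omega -> Rd) : Prop :=
  forall B : set Rd, measurable B -> G (X @^-1` B).

Record filtration (T : R) (F : R -> set (set Omega)) : Prop := {
  filtration_sigma_algebra :
    forall t : R, t \in `[0, T] -> sigma_algebra setT (F t) ;
  filtration_measurable : forall t : R, t \in `[0, T] -> F t `<=` measurable ;
  filtration_nondecreasing :
    forall s t : R, 0 <= s -> s <= t -> t <= T -> F s `<=` F t }.

Definition increment (W : R -> Omega -> Rd) (s t : R) : Omega -> Rd :=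
  fun omega => W t omega - W s omega.

Record brownian_motion (T : R) (F : R -> set (set Omega))
    (W : R -> Omega -> Rd) : Prop := {
  brownian_adapted : forall t : R, t \in `[0, T] -> measurable_wrt (F t) (W t) ;
  brownian_start : {ae P, forall omega, W 0 omega = 0} ;
  brownian_increment_law : forall s t : R, 0 <= s -> s < t -> t <= T ->
    forall B : set Rd, measurable B ->
      P (increment W s t @^-1` B) = gauss_cV d (t - s) B ;
  brownian_increment_indep : forall s t : R, 0 <= s -> s < t -> t <= T ->
    forall (A : set Omega) (B : set Rd), F s A -> measurable B ->
      P (A `&` increment W s t @^-1` B) =
      (P A * P (increment W s t @^-1` B))%E ;
  brownian_continuous :
    {ae P, forall omega, {within `[0, T], continuous (W ^~ omega)}} }.

Definition tgrid (T : R) (N n : nat) : R := n%:R * (T / N%:R).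

Fixpoint euler_maruyama (b : Rd -> Rd) (sigma : Rd -> 'M[R]_d)
    (t : nat -> R) (W : R -> Omega -> Rd) (Z0 : Omega -> Rd) (n : nat) :
    Omega -> Rd :=
  match n with
  | 0 => Z0
  | n'.+1 => fun omega =>
      let z := euler_maruyama b sigma t W Z0 n' omega in
      z + (t n'.+1 - t n') *: b z +
      sigma z *m increment W (t n') (t n'.+1) omega
  end.

Definition msq_loss (X Y : Omega -> Rd) (g u : Rd -> R) : \bar R :=
  'E_P[(fun omega => `|u (X omega) - g (Y omega)| ^+ 2)%R]%E.

End stochastic.

(* The set of all minimizers; [argmin D J = [set u]] says that u is the unique
   one. *)
Definition argmin {R : realType} {U : Type} (D : set U) (J : U -> \bar R) :
    set U :=
  [set u | D u /\ forall v, D v -> (J u <= J v)%E].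

(* Main.v *)
Require Import Defs.
From HB Require Import structures.
From mathcomp Require Import all_boot all_order all_algebra.
From mathcomp Require Import all_classical all_reals all_analysis.
From mathcomp Require Import measurable_realfun ess_sup_inf.
From mathcomp Require Import ring lra.

(* For the given b the operator F_b is multiplication by a smooth function c.
   By Tonelli, the quadratic loss is minimized fibrewise, so the continuous
   function x |-> E[(G_b opi_n)(x + tau b(x) + sigma(x) xi)], xi ~ N(0, tau I),
   is a minimizer, hence equals opi_(n+1): the scheme is a linear one-step
   method S_tau with S_tau phi = E[(1 + tau c) phi (x + tau b + sigma xi)].  It
   is stable, |S_tau phi| <= (1 + K tau) |phi|, and a Taylor expansion, one
   Gaussian coordinate at a time, gives S_tau phi = phi + tau A^* phi +
   O(tau^2).  Combined with the Lipschitz continuity in time of A^* p, this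
   yields the rate for each solution p.  Applied on ever finer grids, the same
   estimate shows that p is unique on the grid points, so the constant does not
   depend on p. *)

Set Implicit Arguments.
Unset Strict Implicit.
Unset Printing Implicit Defensive.

Import Order.TTheory GRing.Theory Num.Theory.
Import numFieldNormedType.Exports.

Local Open Scope classical_set_scope.
Local Open Scope ring_scope.

(** * Uniformly smooth families and Taylor expansions *)

(** All constants have to be uniform both in the time t of p(t) and in the point x at which the
    coefficients are frozen when the Gaussian average is expanded. The expansions are therefore
    stated for families over an arbitrary index type with common bounds, [uCb_infty]; times, and
    pairs made of an index and a frozen point, serve as indices.

    A local error O(tau^2) asks for an expansion to fourth order in the Gaussian variable. Averaging
    over s and -s removes the odd orders, so the second moment and a bound on the fourth suffice.

    The class of p provides no mixed derivatives in t and x, hence no time derivative of A^* p to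
    bound. Its Lipschitz estimate comes instead from the integrated equation, applied to finite
    differences in x with a bound proportional to the steps; the time increments of the space
    derivatives follow in the limit. *)

Lemma MVT0 {R : realType} (g g' : R -> R) :
  (forall s : R, is_derive s 1 g (g' s)) ->
  forall h, exists2 c : R, `|c| <= `|h| & g h - g 0 = h * g' c.
Proof.
move=> dg h.
have C : continuous g.
  move=> s; apply/differentiable_continuous/derivable1_diffP.
  by have [] := dg s.
have [h0|h0] := leP 0 h.
  have [|c] := @MVT_segment R g g' 0 h h0 (fun s _ => dg s).
    exact: continuous_subspaceT.
  rewrite in_itv /= => /andP[c0 ch]; rewrite subr0 => E.
  by exists c; rewrite ?ger0_norm// E mulrC.
have [|c] := @MVT_segment R g g' h 0 (ltW h0) (fun s _ => dg s).
  exact: continuous_subspaceT.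
rewrite in_itv /= => /andP[hc c0] E.
exists c; first by rewrite !ler0_norm ?lerN2// ltW.
by rewrite -opprB E; ring.
Qed.

(** * Directional derivatives and the mean value theorem along lines *)

Section lines.
Context {R : realType} {d : nat}.
Local Notation Rd := 'cV[R]_d.
Implicit Types (f : Rd -> R) (x v : Rd).

Lemma is_derive_line f x v (s : R) : derivable f (x + s *: v) v ->
  is_derive s 1 (fun r : R => f (x + r *: v)) ('D_v f (x + s *: v)).
Proof.
move=> df.
have E : (fun h : R =>
  h^-1 *: (f (x + (h *: (1 : R) + s) *: v) - f (x + s *: v))) =
    (fun h : R => h^-1 *: (f (h *: v + (x + s *: v)) - f (x + s *: v))).
  by apply/funext => h; rewrite scalerDl [h *: 1]mulr1 addrCA.
split; last by rewrite /derive /= E.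
by rewrite /derivable /= E.
Qed.

Lemma MVT_line f x v (h : R) : (forall y, derivable f y v) ->
  exists2 c : R, `|c| <= `|h| & f (x + h *: v) - f x = h * 'D_v f (x + c *: v).
Proof.
move=> df.
have [c ch] := MVT0 (fun s => is_derive_line (df (x + s *: v))) h.
by rewrite scale0r addr0; exists c.
Qed.

(** Expressed through partial derivatives so that it stays within smooth families when [v] depends
    on the index; [is_derive_dird] identifies it with ['D_v f]. *)
Definition dird v f x : R := \sum_(i < d) v i 0 * partial i f x.

(** Continuity of the partial derivatives is enough: the direction is built up one coordinate at a
    time, and each new coordinate contributes, by the mean value theorem, a partial derivative at a
    point that tends to [x]. *)
Lemma is_derive_dird f x v : (forall y i, derivable f y (basis_vec i)) ->
  (forall i, continuous (partial i f)) -> is_derive x v f (dird v f x).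
Proof.
move=> df cf.
have {1}-> : v = \sum_(i < d) v i 0 *: basis_vec i.
  apply/colP => j; rewrite summxE (bigD1 j)//= !mxE !eqxx mulr1 big1 ?addr0//.
  by move=> i ij; rewrite !mxE eq_sym (negbTE ij) mulr0.
rewrite /dird; apply: (big_rec2 (fun u a => is_derive x u f a)) => [|i u a _
  IH].
  exact: is_derive0.
suff L : (fun h : R => h^-1 *: (f (h *: (v i 0 *: basis_vec i + u) + x) - f x))
    @ 0^' --> v i 0 * partial i f x + a.
  split; first by apply/cvg_ex; exists (v i 0 * partial i f x + a).
  exact: cvg_lim L.
pose b := v i 0.
have /choice[c Hc] : forall h : R, exists c : R, `|c| <= `|h * b| /\
    f (x + h *: u + (h * b) *: basis_vec i) - f (x + h *: u) =
    (h * b) * partial i f (x + h *: u + c *: basis_vec i).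
  move=> h.
  by have [c] := @MVT_line f (x + h *: u) (basis_vec i) (h * b) (df ^~ i);
    exists c.
have cvgh : (h : R) @[h --> (0:R)^'] --> (0 : R).
  exact: cvg_within.
have cvgc : c h @[h --> (0:R)^'] --> (0 : R).
  apply/norm_cvg0P; apply: (@squeeze_cvgr _ _ _ _ (cst 0) (fun h => `|h * b|)).
  - by near=> h; rewrite normr_ge0/= (Hc h).1.
  - exact: cvg_cst.
  - have := cvg_norm (cvgMr_tmp (b := b) cvgh).
    by rewrite mul0r normr0; apply.
have cvgp : x + h *: u + c h *: basis_vec i @[h --> (0:R)^'] --> x.
  have := cvgD (cvgD (cvg_cst x) (cvgZr_tmp (a := u) cvgh))
    (cvgZr_tmp (a := basis_vec i : Rd) cvgc).
  by rewrite !scale0r !addr0; apply.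
have L1 : b * partial i f (x + h *: u + c h *: basis_vec i) @[h --> (0:R)^']
    --> b * partial i f x.
  by apply: cvgMl_tmp; apply: (cvg_comp _ _ cvgp); exact: cf.
have L2 : h^-1 *: (f (h *: u + x) - f x) @[h --> (0:R)^'] --> a.
  have [D1 <-] := IH; exact: D1.
apply: cvg_trans (cvgD L1 L2); apply: near_eq_cvg; near=> h.
have h0 : h != 0 by near: h; exact: nbhs_dnbhs_neq.
have E := (Hc h).2.
have -> : h *: (v i 0 *: basis_vec i + u) + x
    = x + h *: u + (h * b) *: basis_vec i.
  by rewrite scalerDr scalerA addrC addrA addrAC.
rewrite -[f (_ + _ *: basis_vec i)](subrK (f (x + h *: u))) E.
rewrite -[LHS]/(b * partial i f (x + h *: u + c h *: basis_vec i)
  + h^-1 *: (f (h *: u + x) - f x)).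
have scE (p q : R) : p *: q = p * q by [].
by rewrite [h *: u + x]addrC !scE; field.
Unshelve. all: by end_near. Qed.

End lines.

(** * Families of smooth functions with common bounds *)

Section uniform_families.
Context {R : realType} {d : nat}.
Local Notation Rd := 'cV[R]_d.

(** The bound [M] is chosen before the index [k]. Recursion on the order, instead of the words of
    coordinates used in [Cb_infty], lets closure under products go by induction on [n] through the
    Leibniz rule. *)
Fixpoint uCb (I : Type) (n : nat) (f : I -> Rd -> R) : Prop :=
  [/\ forall k x i, derivable (f k) x (basis_vec i),
      forall k, continuous (f k),
      exists M : R, forall k x, `|f k x| <= M &
      if n is n'.+1 then forall i, uCb n' (fun k => partial i (f k)) else True].

Definition uCb_infty (I : Type) (f : I -> Rd -> R) : Prop :=
  forall n, uCb n f.

Context {I : Type}.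
Implicit Types (f g : I -> Rd -> R).

Lemma uCb_infty_derivable f k x i : uCb_infty f ->
  derivable (f k) x (basis_vec i).
Proof. by move=> /(_ 0%N)[]. Qed.

Lemma uCb_infty_bounded f : uCb_infty f ->
  exists2 M : R, 0 <= M & forall k x, `|f k x| <= M.
Proof.
move=> /(_ 0%N)[_ _ [M fM] _]; exists `|M| => // k x.
exact: le_trans (fM k x) (ler_norm M).
Qed.

Lemma uCb_infty_partial f i : uCb_infty f ->
  uCb_infty (fun k => partial i (f k)).
Proof. by move=> uf n; have [_ _ _] := uf n.+1; apply. Qed.

Lemma uCb_comp (J : Type) (h : J -> I) n f : uCb n f ->
  uCb n (fun j => f (h j)).
Proof.
elim: n f => [|n IH] f /=.
  by move=> [df cf [M fM] _]; split => //; exists M.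
move=> [df cf [M fM] uf]; split => //; first by exists M.
by move=> i; exact: IH (uf i).
Qed.

Lemma uCb_infty_comp (J : Type) (h : J -> I) f : uCb_infty f ->
  uCb_infty (fun j => f (h j)).
Proof. by move=> uf n; exact: uCb_comp. Qed.

Lemma uCbW n f : uCb n.+1 f -> uCb n f.
Proof.
elim: n f => [|n IH] f; first by move=> [].
by move=> [df cf bf uf]; split => // i; exact: IH (uf i).
Qed.

Lemma uCbD n f g : uCb n f -> uCb n g -> uCb n (fun k x => f k x + g k x).
Proof.
elim: n f g => [|n IH] f g [df cf [M fM] uf] [dg cg [N gN] ug].
  split=> [k x i|k x||].
  - exact: derivableD.
  - exact: cvgD (cf k x) (cg k x).
  - exists (M + N) => k x.
    exact: le_trans (ler_normD _ _) (lerD (fM k x) (gN k x)).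
  - exact: Logic.I.
split=> [k x i|k x||i].
- exact: derivableD.
- exact: cvgD (cf k x) (cg k x).
- exists (M + N) => k x.
  exact: le_trans (ler_normD _ _) (lerD (fM k x) (gN k x)).
have := IH _ _ (uf i) (ug i).
congr (uCb _ _); apply/funext => k; apply/funext => x.
by rewrite /partial (@deriveD _ _ _ (f k) (g k)).
Qed.

Lemma uCbM n f g : uCb n f -> uCb n g -> uCb n (fun k x => f k x * g k x).
Proof.
elim: n f g => [|n IH] f g.
  move=> [df cf [M fM] uf] [dg cg [N gN] ug].
  split=> [k x i|k x||].
  - exact: derivableM.
  - exact: cvgM (cf k x) (cg k x).
  - by exists (M * N) => k x; rewrite normrM ler_pM.
  - exact: Logic.I.
move=> uf0 ug0; have [df cf [M fM] uf] := uf0; have [dg cg [N gN] ug] := ug0.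
split=> [k x i|k x||i].
- exact: derivableM.
- exact: cvgM (cf k x) (cg k x).
- by exists (M * N) => k x; rewrite normrM ler_pM.
have := uCbD (IH _ _ (uCbW uf0) (ug i)) (IH _ _ (uCbW ug0) (uf i)).
congr (uCb _ _); apply/funext => k; apply/funext => x.
by rewrite /partial (@deriveM _ _ (f k) (g k)).
Qed.

Lemma uCb_cst n (a : I -> R) (M : R) : (forall k, `|a k| <= M) ->
  uCb n (fun k (_ : Rd) => a k).
Proof.
elim: n a M => [|n IH] a M aM.
  split=> [k x i|k x||].
  - exact: derivable_cst.
  - exact: cst_continuous.
  - by exists M.
  - exact: Logic.I.
split=> [k x i|k x||i].
- exact: derivable_cst.
- exact: cst_continuous.
- by exists M.
have := IH (fun=> 0) 0; rewrite normr0 => /(_ (fun=> lexx _)).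
congr (uCb _ _); apply/funext => k; apply/funext => x.
by rewrite /partial derive_cst.
Qed.

Lemma uCb_inftyD f g : uCb_infty f -> uCb_infty g ->
  uCb_infty (fun k x => f k x + g k x).
Proof. by move=> uf ug n; exact: uCbD. Qed.

Lemma uCb_inftyM f g : uCb_infty f -> uCb_infty g ->
  uCb_infty (fun k x => f k x * g k x).
Proof. by move=> uf ug n; exact: uCbM. Qed.

(** The value is constant in the space variable but may vary with [k]: this is how frozen
    coefficients enter a family. *)
Lemma uCb_infty_cst (a : I -> R) (M : R) : (forall k, `|a k| <= M) ->
  uCb_infty (fun k (_ : Rd) => a k).
Proof. by move=> aM n; exact: uCb_cst aM. Qed.

Lemma uCb_inftyN f : uCb_infty f -> uCb_infty (fun k x => - f k x).
Proof.
move=> uf.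
have u1 : uCb_infty (fun (_ : I) (_ : Rd) => -1 : R).
  by apply: (@uCb_infty_cst _ 1) => _; rewrite normrN normr1.
have := uCb_inftyM u1 uf.
by congr uCb_infty; apply/funext => k; apply/funext => x; rewrite mulN1r.
Qed.

Lemma uCb_infty_sum (J : Type) (s : seq J) (f : J -> I -> Rd -> R) :
  (forall j, uCb_infty (f j)) -> uCb_infty (fun k x => \sum_(j <- s) f j k x).
Proof.
move=> uf; elim: s => [|j s IH].
  have u0 : uCb_infty (fun (_ : I) (_ : Rd) => 0 : R).
    by apply: (@uCb_infty_cst _ 0) => _; rewrite normr0.
  move: u0; congr uCb_infty; apply/funext => k; apply/funext => x.
  by rewrite big_nil.
have := uCb_inftyD (uf j) IH.
congr uCb_infty; apply/funext => k; apply/funext => x.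
by rewrite big_cons.
Qed.

Definition bounded_vectors (v : I -> Rd) : Prop :=
  exists M : R, forall k i, `|v k i 0| <= M.

Lemma uCb_infty_dird f (v : I -> Rd) : bounded_vectors v -> uCb_infty f ->
  uCb_infty (fun k => dird (v k) (f k)).
Proof.
move=> [M vM] uf; apply: uCb_infty_sum => i; apply: uCb_inftyM.
  by apply: uCb_infty_cst => k; exact: vM.
exact: uCb_infty_partial.
Qed.

Lemma is_derive_family f k (v x : Rd) (s : R) : uCb_infty f ->
  is_derive s 1 (fun r : R => f k (x + r *: v)) (dird v (f k) (x + s *: v)).
Proof.
move=> uf.
have [D <-] : is_derive (x + s *: v) v (f k) (dird v (f k) (x + s *: v)).
  apply: is_derive_dird => [y i|i].
    exact: uCb_infty_derivable.
  by have [_ /(_ k)] := uCb_infty_partial i uf 0%N.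
exact: is_derive_line.
Qed.

End uniform_families.

(** * Taylor estimates uniform over a family *)

Section taylor.
Context {R : realType} {d : nat}.
Local Notation Rd := 'cV[R]_d.

(** The mean value point satisfies |c| <= |s|, so a bound on the derivative gains one power of |s|.
    Iterated, this gives Taylor estimates without factorials, with sup norms of derivatives as
    constants. *)
Lemma power_bound_of_derivative (g g' : R -> R) (C : R) (n : nat) :
  g 0 = 0 -> (forall s : R, is_derive s 1 g (g' s)) ->
  (forall s, `|g' s| <= C * `|s| ^+ n) ->
  forall s, `|g s| <= C * `|s| ^+ n.+1.
Proof.
move=> g0 dg g'C s.
have C0 : 0 <= C by have := g'C 1; rewrite normr1 expr1n mulr1; exact: le_trans.
have [c cs] := MVT0 dg s; rewrite g0 subr0 => ->.
rewrite normrM exprS mulrCA ler_wpM2l//.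
by apply: le_trans (g'C c) _; rewrite ler_wpM2l// lerXn2r ?nnegrE.
Qed.

Context {I : Type}.
Variables (f : I -> Rd -> R) (v : I -> Rd).
Hypotheses (uf : uCb_infty f) (bv : bounded_vectors v).

Let D1 k := dird (v k) (f k).
Let D2 k := dird (v k) (D1 k).
Let D3 k := dird (v k) (D2 k).
Let D4 k := dird (v k) (D3 k).

Let u1 : uCb_infty D1. Proof. exact: uCb_infty_dird. Qed.
Let u2 : uCb_infty D2. Proof. exact: uCb_infty_dird. Qed.
Let u3 : uCb_infty D3. Proof. exact: uCb_infty_dird. Qed.
Let u4 : uCb_infty D4. Proof. exact: uCb_infty_dird. Qed.

Lemma uniform_taylor0 : exists2 C : R, 0 <= C &
  forall k x s, `|f k (x + s *: v k) - f k x| <= C * `|s|.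
Proof.
have [C C0 bC] := uCb_infty_bounded u1.
exists C => // k x s.
rewrite -(expr1 `|s|).
apply: (@power_bound_of_derivative (fun s => f k (x + s *: v k) - f k x)
  (fun s => D1 k (x + s *: v k))) => [|r|r].
- by rewrite scale0r addr0 subrr.
- rewrite -[X in is_derive _ _ _ X]subr0.
  by apply: is_deriveB; exact: is_derive_family.
- by rewrite expr0 mulr1.
Qed.

Lemma uniform_taylor1 : exists2 C : R, 0 <= C &
  forall k x s, `|f k (x + s *: v k) - f k x - s * D1 k x| <= C * s ^+ 2.
Proof.
have [C C0 bC] := uCb_infty_bounded u2.
exists C => // k x s.
rewrite -(ger0_norm (sqr_ge0 s)) normrX.
apply: (@power_bound_of_derivative
  (fun s => f k (x + s *: v k) - f k x - s * D1 k x)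
  (fun s => D1 k (x + s *: v k) - D1 k x)) => [|r|].
- by rewrite scale0r addr0 subrr mul0r subr0.
- have d1 := is_derive_family k (v k) x r uf.
  by apply: is_derive_eq; rewrite subr0 scaler0 add0r [_ *: 1]mulr1.
apply: (@power_bound_of_derivative _
  (fun s => D2 k (x + s *: v k))) => [|r|r].
- by rewrite scale0r addr0 subrr.
- have d1 := is_derive_family k (v k) x r u1.
  by apply: is_derive_eq; rewrite subr0.
- by rewrite expr0 mulr1.
Qed.

(** Adding the values at s and -s cancels the odd orders. The left-hand side vanishes at s = 0
    together with its first three derivatives in s, and the fourth is D4(x + s v) + D4(x - s v),
    whence the constant 2 C after four mean value steps. *)
Lemma uniform_symmetric_taylor : exists2 C : R, 0 <= C & forall k x s,
  `|f k (x + s *: v k) + f k (x - s *: v k) - 2 * f k x - s ^+ 2 * D2 k x|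
  <= C * s ^+ 4.
Proof.
have [C C0 bC] := uCb_infty_bounded u4.
have dN g k x r : uCb_infty g -> is_derive r (1 : R)
    (fun s : R => g k (x - s *: v k)) (- dird (v k) (g k) (x - r *: v k)).
  move=> ug.
  have -> : (fun s : R => g k (x - s *: v k)) =
      (fun s : R => g k (x + s *: v k)) \o -%R.
    by apply/funext => s /=; rewrite scaleNr.
  have d1 := is_derive_family k (v k) x (- r) ug.
  have := is_derive1_comp d1 (is_deriveN (is_derive_id r 1)).
  by rewrite scaleNr mulrN1.
exists (2 * C) => [|k x s]; first by rewrite mulr_ge0.
rewrite -[s ^+ 4]ger0_norm ?exprn_even_ge0// normrX.
apply: (@power_bound_of_derivative
  (fun s => f k (x + s *: v k) + f k (x - s *: v k) - 2 * f k x
     - s ^+ 2 * D2 k x)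
  (fun s => D1 k (x + s *: v k) - D1 k (x - s *: v k) - 2 * s * D2 k x))
   => [|r|].
- by rewrite scale0r subr0 addr0; ring.
- have d1 := is_derive_family k (v k) x r uf.
  have d2 := dN _ k x r uf.
  have d3 : is_derive r 1 (fun s : R => s ^+ 2 * D2 k x) (2 * r * D2 k x).
    by apply: is_derive_eq; rewrite scaler0 add0r /GRing.scale/=; ring.
  have := is_deriveB (is_deriveB (is_deriveD d1 d2) (is_derive_cst (2 * f k x)
    r 1)) d3.
  by rewrite subr0; apply.
apply: (@power_bound_of_derivative _
  (fun s => D2 k (x + s *: v k) + D2 k (x - s *: v k) - 2 * D2 k x))
   => [|r|].
- by rewrite scale0r subr0 addr0; ring.
- have d1 := is_derive_family k (v k) x r u1.
  have d2 := dN _ k x r u1.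
  have d3 : is_derive r 1 (fun s : R => 2 * s * D2 k x) (2 * D2 k x).
    by apply: is_derive_eq; rewrite /GRing.scale/=; ring.
  have := is_deriveB (is_deriveB d1 d2) d3.
  by rewrite opprK; apply.
apply: (@power_bound_of_derivative _
  (fun s => D3 k (x + s *: v k) - D3 k (x - s *: v k)))
   => [|r|].
- by rewrite scale0r subr0 addr0; ring.
- have d1 := is_derive_family k (v k) x r u2.
  have d2 := dN _ k x r u2.
  have := is_deriveB (is_deriveD d1 d2) (is_derive_cst (2 * D2 k x) r 1).
  by rewrite subr0; apply.
apply: (@power_bound_of_derivative _
  (fun s => D4 k (x + s *: v k) + D4 k (x - s *: v k)))
   => [|r|r].
- by rewrite scale0r subr0 addr0; ring.
- have d1 := is_derive_family k (v k) x r u3.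
  have d2 := dN _ k x r u3.
  by have := is_deriveB d1 d2; rewrite opprK; apply.
- rewrite expr0 mulr1 mulrDl mul1r.
  exact: le_trans (ler_normD _ _) (lerD (bC _ _) (bC _ _)).
Qed.

End taylor.

(** * Moments of the normal law *)

Lemma integrable_bounded_mass1 d (T : measurableType d) (R : realType)
  (mu : {measure set T -> \bar R}) (h : T -> R) (M : R) : mu setT = 1%E ->
  measurable_fun setT h -> (forall x, `|h x| <= M) ->
  mu.-integrable setT (EFin \o h).
Proof.
move=> mu1 mh hM; apply: measurable_bounded_integrable => //.
  by rewrite mu1 ltry.
by exists M; split => [|x Mx y _]; [exact: num_real|exact: le_trans (ltW Mx)].
Qed.

Section normal_moments.
Context {R : realType}.
Variable sigma : R.
Hypothesis sigma0 : sigma != 0.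
Local Notation mu := (@lebesgue_measure R).
Local Notation N := (normal_prob 0 sigma).
Local Notation pdf := (normal_pdf 0 sigma).

(** The Radon-Nikodym derivative of the normal law agrees almost everywhere with its density,
    because both have the same integral over every measurable subset. *)
Lemma integral_normal_prob (f : R -> \bar R) (U : set R) : measurable U ->
  N.-integrable U f ->
  (\int[N]_(x in U) f x = \int[mu]_(x in U) (f x * (pdf x)%:E))%E.
Proof.
move=> mU intf.
have mf := measurable_int _ intf.
rewrite -(Radon_Nikodym_change_of_variables (normal_prob_dominates 0 sigma))//=.
apply: ae_eq_integral => //.
- apply: emeasurable_funM => //; apply: (measurable_int mu).
  apply: (integrableS _ _ (@subsetT _ _)) => //=.
  by apply: Radon_Nikodym_integrable; exact: normal_prob_dominates.
- apply: emeasurable_funM => //; apply/measurable_EFinP/measurable_funTS.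
  exact: measurable_normal_pdf.
- apply: ae_eqe_mul2l => /=.
  rewrite Radon_NikodymE//=; first exact: normal_prob_dominates.
  move=> numu.
  case: cid => /= h [h1 h2 h3].
  apply: integral_ae_eq => //=.
  + exact: integrableS h2.
  + by apply/measurable_EFinP/measurable_funTS; exact: measurable_normal_pdf.
  + by move=> E E01 mE; rewrite -h3.
Qed.

(** On compact symmetric intervals continuous functions are integrable and integration by parts
    applies; monotone convergence then leads back to the whole line. *)
Let D (n : nat) : set R := `[- n%:R, n%:R].

Let mD n : measurable (D n). Proof. exact: measurable_itv. Qed.

Lemma cvg_integral_normal_itv (g : R -> R) : continuous g ->
  (forall x, 0 <= g x) ->
  (\int[N]_(x in D n) (g x)%:E @[n --> \oo] --> \int[N]_x (g x)%:E)%E.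
Proof.
move=> cg g0.
have <- : \bigcup_n D n = setT.
  apply/seteqP; split => // x _.
  exists (Num.bound `|x|) => //; rewrite /D/= in_itv/= -ler_norml.
  by apply/ltW/archi_boundP.
apply: ge0_nondecreasing_set_cvg_integral => //.
- move=> m n mn; apply/subsetPset => x; rewrite /D/= !in_itv/= -!ler_norml.
  by move=> /le_trans; apply; rewrite ler_nat.
- move=> n; apply/measurable_EFinP/measurable_funTS.
  exact: continuous_measurable_fun.
- by move=> n x _; rewrite lee_fin.
Qed.

Lemma integrable_normal_itv n (g : R -> R) : continuous g ->
  N.-integrable (D n) (EFin \o g).
Proof.
move=> cg.
have [M [_ HM]] : bounded_set (g @` D n).
  apply: compact_bounded; apply: continuous_compact.
    exact: continuous_subspaceT.
  exact: segment_compact.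
apply: measurable_bounded_integrable => //.
- exact: mD.
- apply: (@le_lt_trans _ _ 1%E); last exact: ltry.
  exact: (probability_le1 (normal_prob 0 sigma) (mD n)).
- by apply: measurable_funTS; exact: continuous_measurable_fun.
- exists M; split; first exact: num_real.
  by move=> x Mx y Dy; apply: HM => //; exists y.
Qed.

Lemma Rintegral_normal_itv n (g : R -> R) : continuous g ->
  \int[N]_(x in D n) g x = \int[mu]_(x in D n) (g x * pdf x).
Proof.
move=> cg; rewrite /Rintegral integral_normal_prob//.
exact: integrable_normal_itv.
Qed.

Lemma normal_pdfN x : pdf (- x) = pdf x.
Proof. by rewrite !normal_pdfE// /normal_fun !subr0 sqrrN. Qed.

Lemma is_derive_normal_pdf (x : R) :
  is_derive x 1 pdf (- (x / sigma ^+ 2) * pdf x).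
Proof.
rewrite !normal_pdfE//.
pose u (y : R) : R := - y ^+ 2 / (sigma ^+ 2 *+ 2).
have -> : (fun y => normal_peak sigma * normal_fun 0 sigma y) =
  (fun y => normal_peak sigma * (expR \o u) y).
  by apply/funext => y; rewrite /normal_fun subr0.
rewrite /normal_fun subr0 -/(u x).
have d1 : is_derive x 1 u (- (x / sigma ^+ 2)).
  apply: is_derive_eq; rewrite /GRing.scale/=; field.
  by rewrite sigma0.
have d2 := is_derive1_comp (is_derive_expR (u x)) d1.
by apply: is_derive_eq; rewrite /GRing.scale/=; ring.
Qed.

(** Stein's identity with its boundary terms: x pdf(x) is the derivative of -sigma^2 pdf(x), so
    integration by parts moves the factor x onto a derivative of F. *)
Lemma Rintegral_normal_parts n (F f : R -> R) :
  (forall x : R, is_derive x 1 F (f x)) -> continuous f ->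
  \int[N]_(x in D n) (F x * x) =
  - sigma ^+ 2 * pdf n%:R * (F n%:R - F (- n%:R))
  + sigma ^+ 2 * \int[N]_(x in D n) f x.
Proof.
move=> dF cf.
have cF : continuous F.
  move=> s; apply/differentiable_continuous/derivable1_diffP.
  by have [] := dF s.
rewrite !Rintegral_normal_itv//; last first.
  by move=> x; apply: cvgM; [exact: cF|exact: cvg_id].
(* For n = 0 the interval is a single point and both sides vanish; integration by parts is applied
   on a nondegenerate interval. *)
case: n => [|n].
  by rewrite /D oppr0 set_itv1 !Rintegral_set1 subrr !mulr0 addr0.
have nn : - n.+1%:R < n.+1%:R :> R by rewrite gtrN// ltr0n.
pose G x := - sigma ^+ 2 * pdf x.
have dG (x : R) : is_derive x 1 G (x * pdf x).
  have d1 := is_derive_normal_pdf x.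
  by apply: is_derive_eq; rewrite /GRing.scale/=; field.
have cG : continuous G.
  move=> s; apply/differentiable_continuous/derivable1_diffP.
  by have [] := dG s.
have LR (H h : R -> R) : (forall x : R, is_derive x 1 H (h x)) ->
    derivable_oo_LRcontinuous H (- n.+1%:R) n.+1%:R.
  move=> dH.
  have cH : continuous H.
    move=> s; apply/differentiable_continuous/derivable1_diffP.
    by have [] := dH s.
  split=> [x _||]; first by have [] := dH x.
  - by apply: cvg_at_right_filter; exact: cH.
  - by apply: cvg_at_left_filter; exact: cH.
transitivity (\int[mu]_(x in D n.+1) (F x * (x * pdf x))).
  by apply: eq_Rintegral => x _; rewrite mulrA.
have cpdf := continuous_normal_pdf (m := 0) sigma0.
rewrite /D (@Rintegration_by_parts _ F G f (fun x => x * pdf x))//.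
- rewrite /G normal_pdfN; set a := (X in _ - X = _).
  have -> : a = - sigma ^+ 2 * \int[mu]_(x in D n.+1) (f x * pdf x).
    rewrite /a -RintegralZl//; last first.
      apply: continuous_compact_integrable; first exact: segment_compact.
      apply: continuous_subspaceT => x.
      by apply: cvgM; [exact: cf|exact: cpdf].
      exact: mD.
    by apply: eq_Rintegral => x _; ring.
  rewrite /D; ring.
- exact: continuous_subspaceT.
- exact: LR dF.
- by move=> x _; rewrite derive1E; have [] := dF x.
- apply: continuous_subspaceT => x.
  by apply: cvgM; [exact: cvg_id|exact: cpdf].
- exact: LR dG.
- by move=> x _; rewrite derive1E; have [] := dG x.
Qed.

(** With y = n^2 / (2 sigma^2), the bound exp(-y) <= 1/y leaves a multiple of 1/n. *)
Let boundary_cvg0 : pdf n%:R * (n%:R - - n%:R) @[n --> \oo] --> (0 : R).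
Proof.
have p0 : 0 < normal_peak sigma by exact: normal_peak_gt0.
have s2 : 0 < sigma ^+ 2 by rewrite exprn_even_gt0.
apply: (@squeeze_cvgr _ _ _ _ (cst 0)
    (fun n => normal_peak sigma * sigma ^+ 2 * 4 * n%:R^-1)); last 2 first.
- exact: cvg_cst.
- rewrite -(mulr0 (normal_peak sigma * sigma ^+ 2 * 4)).
  apply: cvgMl_tmp; apply/gtr0_cvgV0; last exact: cvgr_idn.
  by near=> n; rewrite ltr0n; near: n; exact: nbhs_infty_gt.
near=> n.
have n0 : 0 < n%:R :> R by rewrite ltr0n; near: n; exact: nbhs_infty_gt.
rewrite mulr_ge0 ?normal_pdf_ge0/= ?opprK; last by rewrite addr_ge0.
rewrite normal_pdfE// /normal_fun subr0.
pose y := n%:R ^+ 2 / (sigma ^+ 2 *+ 2).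
have y0 : 0 < y by rewrite divr_gt0// ?exprn_gt0// mulrn_wgt0.
have e1 : expR (- n%:R ^+ 2 / (sigma ^+ 2 *+ 2)) <= y^-1.
  rewrite mulNr expRN lef_pV2 ?posrE ?expR_gt0//.
  by apply: le_trans (expR_ge1Dx y); rewrite lerDr.
have -> : normal_peak sigma * sigma ^+ 2 * 4 * n%:R^-1 =
    normal_peak sigma * y^-1 * (n%:R + n%:R).
  rewrite /y; field.
  by rewrite sigma0 gt_eqF.
rewrite ler_wpM2r ?addr_ge0// ?ler_wpM2l// ltW//.
Unshelve. all: by end_near. Qed.

Lemma EFin_Rintegral_normal_itv n (g : R -> R) : continuous g ->
  (\int[N]_(x in D n) (g x)%:E)%E = (\int[N]_(x in D n) g x)%:E.
Proof.
move=> cg; rewrite /Rintegral fineK//.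
exact: (@integrable_fin_num _ _ _ N _ (mD n) _
  (integrable_normal_itv n cg)).
Qed.

Let cvg_mass : \int[N]_(x in D n) (1 : R) @[n --> \oo] --> (1 : R).
Proof.
have c1 : continuous (fun _ : R => 1 : R) by move=> x; exact: cst_continuous.
have := cvg_integral_normal_itv c1 (fun=> ler01).
rewrite integral_cst//= mul1e probability_setT => /fine_cvg.
exact.
Qed.

(** Stein's identity with F(x) = x and f = 1; the boundary term tends to 0. *)
Lemma normal_second_moment : (\int[N]_x (x ^+ 2)%:E = (sigma ^+ 2)%:E)%E.
Proof.
have c2 : continuous (fun x : R => x ^+ 2) by exact: exprn_continuous.
have c1 : continuous (fun _ : R => 1 : R) by move=> x; exact: cst_continuous.
suff L : (\int[N]_(x in D n) (x ^+ 2)%:E @[n --> \oo] --> (sigma ^+ 2)%:E)%E.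
  exact: cvg_unique (cvg_integral_normal_itv c2 (@sqr_ge0 R)) L.
under eq_fun do rewrite EFin_Rintegral_normal_itv//.
apply: cvg_EFin; first by apply: nearW.
have -> : fine \o (fun n => (\int[N]_(x in D n) (x ^+ 2))%:E) = fun n =>
    - sigma ^+ 2 * (pdf n%:R * (n%:R - - n%:R)) +
    sigma ^+ 2 * \int[N]_(x in D n) (1 : R).
  apply/funext => n /=.
  by rewrite mulrA -(Rintegral_normal_parts n (fun x => is_derive_id x 1) c1).
have := cvgD (cvgMl_tmp (a := - sigma ^+ 2) boundary_cvg0)
  (cvgMl_tmp (a := sigma ^+ 2) cvg_mass).
by rewrite mulr0 add0r mulr1; apply.
Qed.

(** Stein's identity with F(x) = x^3. The boundary term is nonpositive and is simply dropped, which
    yields an inequality; that is enough for a remainder. *)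
Lemma normal_fourth_moment :
  (\int[N]_x (x ^+ 4)%:E <= (3 * sigma ^+ 4)%:E)%E.
Proof.
have c3 : continuous (fun x : R => x ^+ 3) by exact: exprn_continuous.
have c4 : continuous (fun x : R => x ^+ 4) by exact: exprn_continuous.
have c2 : continuous (fun x : R => x ^+ 2) by exact: exprn_continuous.
have c32 : continuous (fun x : R => 3 * x ^+ 2).
  by move=> x; apply: cvgMl_tmp; exact: c2.
have d3 (x : R) : is_derive x 1 (fun x : R => x ^+ 3) (3 * x ^+ 2).
  by apply: is_derive_eq; rewrite /GRing.scale/=; ring.
have p4 (x : R) : 0 <= x ^+ 4 by rewrite exprn_even_ge0.
have C := cvg_integral_normal_itv c4 p4.
rewrite -(cvg_lim _ C)//; apply: lime_le; first by apply/cvg_ex; eexists;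
  exact: C.
apply: nearW => n; rewrite EFin_Rintegral_normal_itv// lee_fin.
have -> : \int[N]_(x in D n) x ^+ 4 = \int[N]_(x in D n) (x ^+ 3 * x).
  by apply: eq_Rintegral => x _; rewrite -exprSr.
rewrite (Rintegral_normal_parts n d3 c32).
rewrite RintegralZl//; last exact: (integrable_normal_itv n c2).
  rewrite -[leRHS]add0r lerD//.
    have -> : (- n%:R : R) ^+ 3 = - n%:R ^+ 3 by ring.
    rewrite opprK mulNr mulNr oppr_le0; apply: mulr_ge0.
      by apply: mulr_ge0; [exact: sqr_ge0|exact: normal_pdf_ge0].
    by rewrite addr_ge0 ?exprn_ge0.
  have -> : 3 * sigma ^+ 4 = sigma ^+ 2 * (3 * sigma ^+ 2) by ring.
  rewrite !ler_wpM2l ?sqr_ge0// -lee_fin.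
  rewrite -EFin_Rintegral_normal_itv// -normal_second_moment.
  apply: ge0_subset_integral => //.
  - exact: mD.
  - by apply/measurable_EFinP; exact: continuous_measurable_fun.
  - by move=> x _; rewrite lee_fin sqr_ge0.
exact: mD.
Qed.

Lemma integral_normalN (h : R -> R) : continuous h -> (forall x, 0 <= h x) ->
  (\int[N]_x (h (- x))%:E = \int[N]_x (h x)%:E)%E.
Proof.
move=> ch h0.
have chN : continuous (h \o -%R).
  by move=> x; apply: continuous_comp; [exact: opp_continuous|exact: ch].
suff E n : (\int[N]_(x in D n) (h (- x))%:E = \int[N]_(x in D n) (h x)%:E)%E.
  have L := cvg_integral_normal_itv chN (fun x => h0 (- x)).
  have L' : (\int[N]_(x in D n) (h (- x))%:E @[n --> \oo]
      --> \int[N]_x (h x)%:E)%E.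
    by under eq_fun do rewrite E; exact: cvg_integral_normal_itv.
  exact: cvg_unique L L'.
rewrite !EFin_Rintegral_normal_itv//; congr EFin.
rewrite !Rintegral_normal_itv// /Rintegral; congr fine.
have nn : - n%:R <= n%:R :> R by rewrite ge0_cp.
have := @integration_by_substitution_oppr R (fun x => h x * pdf x) _ _ nn.
rewrite opprK => ->.
  by apply: eq_integral => x _ /=; rewrite normal_pdfN.
apply: continuous_subspaceT => x; apply: cvgM; first exact: ch.
exact: continuous_normal_pdf.
Qed.

Lemma integrable_normal_nonneg (h : R -> R) (c : R) : continuous h ->
  (forall x, 0 <= h x) -> (\int[N]_x (h x)%:E <= c%:E)%E ->
  N.-integrable setT (EFin \o h).
Proof.
move=> ch h0 hc; apply/integrableP; split.
  by apply/measurable_EFinP; exact: continuous_measurable_fun.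
under eq_integral do rewrite /= ger0_norm//.
by apply: le_lt_trans hc _; exact: ltry.
Qed.

(** By symmetry of the law, the integral of h is half that of h(x) + h(-x), to which the symmetric
    expansion applies; [A] stands for the second derivative at 0. The fourth moment gives 3/2 C
    sigma^4, rounded up to 2 C sigma^4. *)
Lemma normal_taylor (h : R -> R) (M A C : R) : continuous h ->
  (forall x, `|h x| <= M) ->
  (forall s, `|h s + h (- s) - 2 * h 0 - s ^+ 2 * A| <= C * s ^+ 4) ->
  `|\int[N]_x h x - h 0 - sigma ^+ 2 / 2 * A| <= 2 * C * sigma ^+ 4.
Proof.
have aux (c a : R) : 0 <= c * a -> c * (3 * a) <= 2 * (2 * c * a) by lra.
move=> ch hM hT.
have mT : measurable [set: measurableTypeR R] by [].
have C0 : 0 <= C.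
  by have := hT 1; rewrite !expr1n mulr1; exact: le_trans.
have chN : continuous (fun x => h (- x)).
  by move=> x; apply: continuous_comp; [exact: opp_continuous|exact: ch].
have c2 : continuous (fun x : R => x ^+ 2) by exact: exprn_continuous.
have c4 : continuous (fun x : R => x ^+ 4) by exact: exprn_continuous.
have p4 (x : R) : 0 <= x ^+ 4 by rewrite exprn_even_ge0.
have i2 : N.-integrable setT (EFin \o (fun x : R => x ^+ 2)).
  apply: (integrable_normal_nonneg c2 (@sqr_ge0 R)).
  by rewrite normal_second_moment.
have i4 : N.-integrable setT (EFin \o (fun x : R => x ^+ 4)).
  exact: (integrable_normal_nonneg c4 p4 normal_fourth_moment).
have ib (g : R -> R) B : continuous g -> (forall x, `|g x| <= B :> R) ->
    N.-integrable setT (EFin \o g).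
  move=> cg gB.
  apply: (@integrable_bounded_mass1 _ (measurableTypeR R) R N g B _ _ gB).
    exact: (probability_setT (normal_prob 0 sigma)).
  exact: continuous_measurable_fun.
have ih := ib h M ch hM.
have ihN := ib _ M chN (fun x => hM (- x)).
have ic (c : R) : N.-integrable setT (EFin \o (fun _ : R => c)).
  by apply: (ib _ `|c|) => // x; exact: cst_continuous.
have EN : \int[N]_x h (- x) = \int[N]_x h x.
  (* Reflection is available for nonnegative functions, so h is first raised by its bound M. *)
  have chM : continuous (fun x => h x + M).
    by move=> x; apply: cvgD; [exact: ch|exact: cvg_cst].
  have := integral_normalN chM.
  have hM0 x : 0 <= h x + M.
    by have := hM x; rewrite ler_norml -subr_ge0 opprK => /andP[].
  move=> /(_ hM0)/(congr1 fine); rewrite -![fine _]/(Rintegral _ _ _).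
  rewrite (RintegralD mT ihN (ic M)) (RintegralD mT ih (ic M)).
  exact: addIr.
have i1 := integrableD mT ih ihN.
have E : \int[N]_x (h x + h (- x) - 2 * h 0 - x ^+ 2 * A) =
    2 * \int[N]_x h x - 2 * h 0 - sigma ^+ 2 * A.
  rewrite RintegralB//; last first.
  - by have := integrableZr mT A i2; apply: eq_integrable.
  - have := integrableB mT i1 (ic (2 * h 0)); apply: eq_integrable => //.
  rewrite (RintegralB mT i1 (ic (2 * h 0))) (RintegralD mT ih ihN) EN.
  rewrite (RintegralZr A mT i2) (Rintegral_cst N mT (2 * h 0)).
  have -> : fine (N setT) = 1.
    exact: (congr1 fine (probability_setT (normal_prob 0 sigma))).
  have -> : \int[N]_x x ^+ 2 = sigma ^+ 2.
    by rewrite /Rintegral normal_second_moment.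
  by ring.
have -> : \int[N]_x h x - h 0 - sigma ^+ 2 / 2 * A =
    2^-1 * \int[N]_x (h x + h (- x) - 2 * h 0 - x ^+ 2 * A).
  by rewrite E; field.
rewrite normrM ger0_norm ?invr_ge0//.
have ig : N.-integrable setT
    (EFin \o (fun x => h x + h (- x) - 2 * h 0 - x ^+ 2 * A)).
  have i3 := integrableB mT i1 (ic (2 * h 0)).
  have i5 := integrableB mT i3 (integrableZr mT A i2).
  by apply: eq_integrable i5.
have := le_normr_Rintegral mT ig => /le_trans.
rewrite ler_pdivrMl// => /(_ _ _)/le_trans; apply.
  apply: (le_Rintegral mT (integrable_norm ig) (integrableZl mT C i4)).
  by move=> x _; exact: hT.
rewrite (RintegralZl C mT i4).
have : \int[N]_x x ^+ 4 <= 3 * sigma ^+ 4.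
  rewrite -lee_fin /Rintegral fineK; first exact: normal_fourth_moment.
  exact: (@integrable_fin_num _ _ _ N _ mT _ i4).
move=> /(ler_wpM2l C0)/le_trans; apply.
by apply: aux; rewrite mulr_ge0// exprn_even_ge0.
Qed.

End normal_moments.

(** * Measurability of continuous functions of several variables *)

Section euclidean_measurability.
Context {R : realType} {n : nat}.
Local Notation Rn := 'cV[R]_n.

Lemma cvg_coord (T : Type) (F : set_system T) (FF : Filter F)
  (g : T -> Rn) (x : Rn) :
  (forall i, g t i 0 @[t --> F] --> x i 0) -> g @ F --> x.
Proof.
move=> gx; apply/cvg_ballP => e e0.
have H i : \forall t \near F, ball (x i 0) e (g t i 0).
  by have /cvg_ballP := gx i; apply.
apply: filterS (filter_forall _ H) => t xt; split => // i j; rewrite [j]ord1;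
  exact: xt.
Qed.

(** The sigma-algebra is generated by the coordinates, not by the open sets. The function is the
    pointwise limit of its values at points rounded down to a grid of mesh 1/(k+1); rounding takes
    countably many values, and each of its fibres is a box, a finite intersection of coordinate
    preimages. *)
Lemma continuous_measurable_cV (f : Rn -> R) : continuous f ->
  measurable_fun [set: Rn] f.
Proof.
move=> cf.
pose fl k (x : Rn) : 'cV[int]_n := \col_i Num.floor (x i 0 * k.+1%:R).
pose rnd k (z : 'cV[int]_n) : Rn := \col_i ((z i 0)%:~R / k.+1%:R).
apply: (@measurable_fun_cvg _ _ _ _ (fun k x => f (rnd k (fl k x)))).
  move=> k _ Y mY; rewrite setTI.
  have -> : (fun x => f (rnd k (fl k x))) @^-1` Y =
      \bigcup_(z in [set z | Y (f (rnd k z))]) (fl k @^-1` [set z]).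
    apply/seteqP; split => x /=; first by move=> Yx; exists (fl k x).
    by move=> [z Yz /= ->].
  rewrite bigcup_mkcond; apply: countable_bigcupT_measurable => [|z].
    exact: countableP.
  case: ifPn => // _.
  have -> : fl k @^-1` [set z] = \bigcap_(i in [set: 'I_n])
      ((fun x : Rn => x i 0 : R) @^-1`
        ([set` `[(z i 0)%:~R / k.+1%:R, (z i 0 + 1)%:~R / k.+1%:R[])).
    apply/seteqP; split => x /=.
      move=> <- i _ /=; rewrite in_itv/= !mxE.
      by rewrite ler_pdivrMr// ltr_pdivlMr// floor_itv.
    move=> H; apply/colP => i; rewrite mxE; apply: floor_def.
    have := H i Logic.I; rewrite /= in_itv/=.
    by rewrite ler_pdivrMr// ltr_pdivlMr.
  apply: fin_bigcap_measurable => [|i _]; first exact: finite_finset.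
  by rewrite -[X in measurable X]setTI; apply: measurable_coord.
move=> x _.
have : rnd k (fl k x) @[k --> \oo] --> x.
  apply: cvg_coord => i.
  apply: (@squeeze_cvgr _ _ _ _ (fun k : nat => x i 0 - k.+1%:R^-1)
    (fun=> x i 0)); last 2 first.
  - have := cvgB (cvg_cst (x i 0)) (@cvg_harmonic R).
    by rewrite subr0; apply.
  - exact: cvg_cst.
  apply: nearW => k; rewrite !mxE.
  rewrite ler_pdivrMr// floor_le andbT ler_pdivlMr// mulrBl mulVf//.
  by rewrite lerBlDr -[_ + 1](intrD _ _ 1) ltW// floorD1_gt.
by move=> /(cvg_comp _ f); apply; exact: cf.
Qed.

End euclidean_measurability.

(** * Gaussian averages in several variables *)

Section mass_one.
Context d (T : measurableType d) (R : realType).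
Variable mu : {measure set T -> \bar R}.
Hypothesis mu1 : mu setT = 1%E.

(** Mass one is a hypothesis and not part of the type of the measure, since [gauss_cV] is packaged
    as a sigma-finite measure only. *)
Lemma Rintegral_mass1_dist (g h : T -> R) (c : R) :
  mu.-integrable setT (EFin \o g) -> mu.-integrable setT (EFin \o h) ->
  (forall x, `|g x - h x| <= c) ->
  `|\int[mu]_x g x - \int[mu]_x h x| <= c.
Proof.
move=> ig ih ghc.
have igh := integrableB measurableT ig ih.
rewrite -RintegralB//.
apply: le_trans (le_normr_Rintegral measurableT igh) _.
have -> : c = \int[mu]_(x in setT) c.
  by rewrite Rintegral_cst// mu1 mulr1.
apply: le_Rintegral => //; first exact: (integrable_norm igh).
apply: (@integrable_bounded_mass1 _ _ _ _ _ `|c|) => //.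
Qed.

Lemma Rintegral_mass1_bound (g : T -> R) (c : R) :
  measurable_fun setT g -> (forall x, `|g x| <= c) -> `|\int[mu]_x g x| <= c.
Proof.
move=> mg gc.
have ig := integrable_bounded_mass1 mu1 mg gc.
have i0 : mu.-integrable setT (EFin \o (fun=> 0 : R)).
  by apply: (@integrable_bounded_mass1 _ _ _ _ _ 0) => // x; rewrite normr0.
have := Rintegral_mass1_dist (c := c) ig i0.
rewrite Rintegral_cst// mul0r subr0; apply => x.
by rewrite subr0.
Qed.

End mass_one.

(** * Iterated integrals over the powers of a measure *)

Section measure_powers.
Context {R : realType}.

Section cons.
Variables (n : nat) (m1 : {sigma_finite_measure set (measurableTypeR R) ->
  \bar R})
  (m2 : {sigma_finite_measure set 'cV[R]_n -> \bar R}).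
Hypotheses (m1T : m1 setT = 1%E) (m2T : m2 setT = 1%E).

Lemma product_mass1 : (m1 \x m2)%E setT = 1%E.
Proof.
rewrite -setXTT (product_measure1E m1 m2 measurableT measurableT) -[RHS]mule1.
by congr (_ * _)%E; [exact: m1T|exact: m2T].
Qed.

Lemma cons_measure_mass1 : cons_measure m1 m2 setT = 1%E.
Proof. by rewrite /cons_measure /pushforward preimage_setT product_mass1. Qed.

Variables (h : 'cV[R]_n.+1 -> R) (M : R).
Hypotheses (mh : measurable_fun setT h) (hM : forall x, `|h x| <= M).

Let mh2 : measurable_fun setT (h \o @cons_cV R n).
Proof. by apply: measurableT_comp mh _; exact: measurable_cons_cV. Qed.

Let i2 : (m1 \x m2)%E.-integrable setT (EFin \o (h \o @cons_cV R n)).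
Proof.
apply: (integrable_bounded_mass1 _ mh2 (fun x => hM _)).
exact: product_mass1.
Qed.

Let inner s : m2.-integrable setT (EFin \o (fun w => h (cons_cV (s, w)))).
Proof.
apply: (integrable_bounded_mass1 m2T _ (fun x => hM _)).
apply: measurableT_comp mh2 _; exact: measurable_pair1.
Qed.

Let innerE : fubini_F m2 (EFin \o (h \o @cons_cV R n)) =
  EFin \o (fun s => \int[m2]_w h (cons_cV (s, w))).
Proof.
apply/funext => s; rewrite /fubini_F /= /Rintegral fineK//.
exact: (@integrable_fin_num _ _ _ m2 _ measurableT _ (inner s)).
Qed.

Lemma integrable_cons_inner :
  m1.-integrable setT (EFin \o (fun s => \int[m2]_w h (cons_cV (s, w)))).
Proof. by rewrite -innerE; exact: integrable_fubini_F. Qed.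

(** Change of variables along [cons_cV], then Fubini. The recursion of [measure_pow] thus becomes
    integration over one coordinate at a time, the first coordinate outermost. *)
Lemma Rintegral_cons_measure : \int[cons_measure m1 m2]_x h x =
  \int[m1]_s \int[m2]_w h (cons_cV (s, w)).
Proof.
rewrite /Rintegral; congr fine.
rewrite integral_pushforward//; last 2 first.
- exact: measurable_cons_cV.
- exact/measurable_EFinP.
rewrite preimage_setT -[LHS](integral12_prod_meas1 i2) innerE.
by apply: eq_integral => s _ /=.
Qed.

End cons.

Lemma gauss_mass1 n (t : R) : gauss_cV n t setT = 1%E.
Proof.
rewrite /gauss_cV; elim: n => [|n IH]; first by rewrite /= diracT.
apply: cons_measure_mass1 => //.
exact: (probability_setT (normal_prob 0 (Num.sqrt t))).
Qed.

End measure_powers.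

Section gauss_taylor.
Context {R : realType} {d : nat}.
Local Notation Rd := 'cV[R]_d.

Lemma measurable_affine m (x : Rd) (V : 'M[R]_(d, m)) :
  measurable_fun setT (fun w : 'cV[R]_m => x + V *m w).
Proof.
apply: measurable_fun_coordP => i.
under eq_fun do rewrite !mxE.
apply: measurable_funD => //; apply: measurable_sum => j.
by apply: measurable_funM => //; exact: measurable_coord.
Qed.

Lemma continuous_line (f : Rd -> R) (x v : Rd) : continuous f ->
  continuous (fun s : R => f (x + s *: v)).
Proof.
move=> cf s; apply: (cvg_comp _ f); last exact: cf.
by apply: cvgD; [exact: cvg_cst|apply: cvgZr_tmp; exact: cvg_id].
Qed.

Lemma mulmx_cons_cV m (V : 'M[R]_(d, m.+1)) s (w : 'cV[R]_m) :
  V *m cons_cV (s, w) = s *: col 0 V + rsubmx (V : 'M[R]_(d, 1 + m)) *m w.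
Proof.
rewrite /cons_cV -[in LHS](hsubmxK (V : 'M[R]_(d, 1 + m))).
rewrite [LHS](@mul_row_col _ d 1 m 1); congr (_ + _).
apply/colP => i; rewrite !mxE big_ord1 !mxE eqxx mulr1n mulrC; congr (_ * V _
  _).
exact: val_inj.
Qed.

Context {I : Type}.

Lemma normal_line_taylor (f : I -> Rd -> R) (v : I -> Rd) :
  uCb_infty f -> bounded_vectors v -> exists2 C : R, 0 <= C &
  forall k x (t : R), 0 < t ->
    `|\int[normal_prob 0 (Num.sqrt t)]_s f k (x + s *: v k) - f k x
       - t / 2 * dird (v k) (dird (v k) (f k)) x| <= C * t ^+ 2.
Proof.
move=> uf bv; have [C C0 HC] := uniform_symmetric_taylor uf bv.
have [M M0 fM] := uCb_infty_bounded uf.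
exists (2 * C) => [|k x t t0]; first by rewrite mulr_ge0.
have st0 : Num.sqrt t != 0 by rewrite gt_eqF// sqrtr_gt0.
have cf : continuous (fun s : R => f k (x + s *: v k)).
  by apply: continuous_line; have [_ /(_ k)] := uf 0%N.
have := @normal_taylor R _ st0 _ M (dird (v k) (dird (v k) (f k)) x) C cf.
rewrite scale0r addr0 (sqr_sqrtr (ltW t0)).
have -> : Num.sqrt t ^+ 4 = t ^+ 2.
  by rewrite (exprM _ 2 2) (sqr_sqrtr (ltW t0)).
apply=> s; first exact: fM.
by rewrite scaleNr; exact: HC.
Qed.

(** Induction on the number m of Gaussian coordinates, kept separate from the dimension d of the
    space so that columns of V can be removed. The inner average over the last coordinates is f +
    t/2 L + O(t^2) at every point, uniformly; averaging this over the first coordinate produces the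
    missing column. *)
Lemma gauss_taylor m (f : I -> Rd -> R) (V : I -> 'M[R]_(d, m)) :
  uCb_infty f -> (forall j, bounded_vectors (fun k => col j (V k))) ->
  exists2 C : R, 0 <= C & forall k x (t : R), 0 < t -> t <= 1 ->
    `|\int[gauss_cV m t]_w f k (x + V k *m w) - f k x
       - t / 2 * \sum_(j < m) dird (col j (V k)) (dird (col j (V k)) (f k)) x|
    <= C * t ^+ 2.
Proof.
elim: m f V => [|m IH] f V uf bV.
  exists 0 => // k x t _ _; rewrite /gauss_cV /=.
  rewrite /Rintegral integral_dirac//; last first.
    apply/measurable_EFinP; apply: measurableT_comp (measurable_affine _ _).
    by apply: continuous_measurable_cV; have [_ /(_ k)] := uf 0%N.
  by rewrite diracT mul1e /= mulmx0 addr0 big_ord0 subrr mulr0 subr0 normr0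
    mul0r.
pose v k := col 0 (V k).
pose V' k : 'M[R]_(d, m) := rsubmx (V k : 'M[R]_(d, 1 + m)).
have colV' j k : col j (V' k) = col (lift ord0 j) (V k).
  apply/colP => i; rewrite !mxE; congr (V k _ _).
  exact: val_inj.
have bV' j : bounded_vectors (fun k => col j (V' k)).
  have [M VM] := bV (lift ord0 j).
  by exists M => k i; rewrite colV'.
pose L k y := \sum_(j < m) dird (col j (V' k)) (dird (col j (V' k)) (f k)) y.
have uL : uCb_infty L.
  by apply: uCb_infty_sum => j; do 2 apply: uCb_infty_dird => //.
have bv : bounded_vectors v by exact: bV.
have [C1 C10 H1] := IH f V' uf bV'.
have [C2 C20 H2] := normal_line_taylor uf bv.
have [C3 C30 H3] := normal_line_taylor uL bv.
have uDL : uCb_infty (fun k => dird (v k) (dird (v k) (L k))).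
  by do 2 apply: uCb_infty_dird => //.
have [C4 C40 H4] := uCb_infty_bounded uDL.
have [M M0 fM] := uCb_infty_bounded uf.
have [ML ML0 LM] := uCb_infty_bounded uL.
exists (C1 + C2 + (C3 + C4)) => [|k x t t0 t1]; first by rewrite !addr_ge0.
pose N : {sigma_finite_measure set (measurableTypeR R) -> \bar R} :=
  normal_prob 0 (Num.sqrt t).
have N1 : N setT =
  1%E by exact: (probability_setT (normal_prob 0 (Num.sqrt t))).
pose h y := \int[gauss_cV m t]_w f k (y + V' k *m w).
have mf : measurable_fun setT (f k).
  by apply: continuous_measurable_cV; have [_ /(_ k)] := uf 0%N.
have mg : measurable_fun setT (fun w : 'cV[R]_m.+1 => f k (x + V k *m w)).
  exact: measurableT_comp mf (measurable_affine _ _).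
have inE s w : f k (x + V k *m cons_cV (s, w)) =
    f k (x + s *: v k + V' k *m w).
  by rewrite mulmx_cons_cV addrA.
have E : \int[gauss_cV m.+1 t]_w f k (x + V k *m w) =
    \int[N]_s h (x + s *: v k).
  rewrite [LHS](@Rintegral_cons_measure R m N (gauss_cV m t) N1 (gauss_mass1 m
    t)
    _ M mg (fun=> fM _ _)).
  by apply: eq_Rintegral => s _; apply: eq_Rintegral => w _; exact: inE.
have ih : N.-integrable setT (EFin \o (fun s => h (x + s *: v k))).
  have := @integrable_cons_inner R m N (gauss_cV m t) N1 (gauss_mass1 m t)
    _ M mg (fun=> fM _ _).
  congr (_.-integrable _ _); apply/funext => s /=; congr EFin.
  by apply: eq_Rintegral => w _; exact: inE.
have ib (g : I -> Rd -> R) B : uCb_infty g -> (forall k x, `|g k x| <= B) ->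
    N.-integrable setT (EFin \o (fun s => g k (x + s *: v k))).
  move=> ug gB.
  apply: (@integrable_bounded_mass1 _ _ _ _ _ B N1) => //.
  apply: continuous_measurable_fun; apply: continuous_line.
  by have [_ /(_ k)] := ug 0%N.
have if_ := ib f M uf fM.
have iL := ib L ML uL LM.
have itL := integrableZl measurableT (t / 2) iL.
have ifL := integrableD measurableT if_ itL.
have D1 : `|\int[N]_s h (x + s *: v k) -
    \int[N]_s (f k (x + s *: v k) + t / 2 * L k (x + s *: v k))|
    <= C1 * t ^+ 2.
  apply: (Rintegral_mass1_dist N1 ih ifL) => s.
  by rewrite opprD addrA; exact: H1.
have := D1; rewrite RintegralD// RintegralZl// => {}D1.
rewrite E big_ord_recl -/(v k).
have -> : \sum_(i < m) dird (col (lift ord0 i) (V k))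
    (dird (col (lift ord0 i) (V k)) (f k)) x = L k x.
  by apply: eq_bigr => j _; rewrite colV'.
have := H2 k x t t0; have := H3 k x t t0; have := H4 k x; move: D1.
rewrite -/N.
set a := \int[N]_s h _; set b := \int[N]_s f k _; set c := \int[N]_s L k _.
set l := L k x; set D2f := dird (v k) (dird (v k) (f k)) x.
set D2L := dird _ (dird _ (L k)) x; set f0 := f k x.
clear -t0 t1 C10 C20 C30 C40.
move=> D1 D4 D3 D2.
(* The four errors are: the inner expansion (C1), the first coordinate acting on f (C2), the first
   coordinate acting on L (C3), and the cross term t^2/4 D2L (C4). The third carries an extra factor
   t/2, absorbed by t <= 1. *)
have -> : a - f0 - t / 2 * (D2f + l) = (a - (b + t / 2 * c)) +
  (b - f0 - t / 2 * D2f) + (t / 2 * (c - l - t / 2 * D2L) + t ^+ 2 / 4 * D2L).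
  by field.
apply: le_trans (ler_normD _ _) _; rewrite mulrDl lerD//.
  by apply: le_trans (ler_normD _ _) _; rewrite mulrDl lerD.
apply: le_trans (ler_normD _ _) _; rewrite mulrDl lerD// normrM.
  rewrite ger0_norm ?divr_ge0 ?(ltW t0)//.
  apply: (@le_trans _ _ (1 * (C3 * t ^+ 2))); last by rewrite mul1r.
  apply: ler_pM => //; first by rewrite divr_ge0// ltW.
  by rewrite ler_pdivrMr// mul1r (le_trans t1)// ler1n.
rewrite ger0_norm ?divr_ge0 ?sqr_ge0// mulrC ler_pM ?divr_ge0 ?sqr_ge0//.
by rewrite ler_pdivrMr// ler_peMr ?sqr_ge0// ler1n.
Qed.

End gauss_taylor.

(** * The Fokker-Planck operator and the one-step scheme *)

Section operators.
Context {R : realType} {d : nat}.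
Local Notation Rd := 'cV[R]_d.

Lemma Cb_infty_uniform (I : Type) (f : Rd -> R) : Cb_infty f ->
  uCb_infty (fun _ : I => f).
Proof.
move=> cf n; rewrite -[f]/(partials [::] f).
elim: n [::] => [|n IH] s; have [ds cs [M bs]] := cf s; split=> [_|_||].
- exact: ds.
- exact: cs.
- by exists M.
- exact: Logic.I.
- exact: ds.
- exact: cs.
- by exists M.
- by move=> i; exact: (IH (i :: s)).
Qed.

(** The one-element family, so that the closure lemmas for families serve single functions too. *)
Definition smooth (f : Rd -> R) := uCb_infty (fun _ : unit => f).

Lemma smooth_family (I : Type) (f : I -> Rd -> R) k :
  uCb_infty f -> smooth (f k).
Proof. exact: (@uCb_infty_comp _ _ _ unit (fun=> k)). Qed.

Lemma family_smooth (I : Type) (f : Rd -> R) :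
  smooth f -> uCb_infty (fun _ : I => f).
Proof. exact: (@uCb_infty_comp _ _ _ I (fun=> tt)). Qed.

Lemma smooth_derivable f x i : smooth f -> derivable f x (basis_vec i).
Proof. by move=> /(_ 0%N)[/(_ tt x i)]. Qed.

Lemma smooth_continuous f : smooth f -> continuous f.
Proof. by move=> /(_ 0%N)[_ /(_ tt)]. Qed.

Lemma smooth_partial f i : smooth f -> smooth (partial i f).
Proof. exact: uCb_infty_partial. Qed.

Lemma partialM (f g : Rd -> R) i : smooth f -> smooth g ->
  partial i (fun y => f y * g y) =
  (fun y => partial i f y * g y + f y * partial i g y).
Proof.
move=> sf sg; apply/funext => x.
have df := @smooth_derivable f x i sf.
have dg := @smooth_derivable g x i sg.
by rewrite /partial (@deriveM _ _ f g _ _ df dg) addrC; congr (_ + _);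
  exact: mulrC.
Qed.

Lemma partialD (f g : Rd -> R) i : smooth f -> smooth g ->
  partial i (fun y => f y + g y) = (fun y => partial i f y + partial i g y).
Proof.
move=> sf sg; apply/funext => x.
have df := @smooth_derivable f x i sf.
have dg := @smooth_derivable g x i sg.
by rewrite /partial (@deriveD _ _ _ f g).
Qed.

Lemma smooth_cst (a : R) : smooth (fun=> a).
Proof. exact: (@uCb_infty_cst _ _ _ _ `|a|). Qed.

Lemma partial_dird (v : Rd) f i : smooth f ->
  partial i (dird v f) = (fun x =>
    \sum_(j < d) v j 0 * partial i (partial j f) x).
Proof.
move=> sf; rewrite /dird.
suff [_ ->] : smooth (fun x => \sum_(j < d) v j 0 * partial j f x) /\
    partial i (fun x => \sum_(j < d) v j 0 * partial j f x) =
    (fun x => \sum_(j < d) v j 0 * partial i (partial j f) x) by [].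
elim: (index_enum _) => [|j s [IH1 IH2]].
  have -> : (fun x : Rd => \sum_(j <- [::]) v j 0 * partial j f x) = fun=> 0.
    by apply/funext => x; rewrite big_nil.
  split; first exact: smooth_cst.
  by apply/funext => x; rewrite big_nil /partial derive_cst.
have -> : (fun x : Rd => \sum_(j <- j :: s) v j 0 * partial j f x) =
    (fun x => v j 0 * partial j f x + \sum_(j <- s) v j 0 * partial j f x).
  by apply/funext => x; rewrite big_cons.
have s1 := smooth_cst (v j 0).
have s2 : smooth (fun x => v j 0 * partial j f x).
  exact: uCb_inftyM s1 (smooth_partial j sf).
split; first exact: uCb_inftyD s2 IH1.
rewrite (partialD _ s2 IH1) (partialM _ s1 (smooth_partial j sf)) IH2.
apply/funext => x; rewrite big_cons; congr (_ + _).
by rewrite {1}/partial derive_cst mul0r add0r.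
Qed.

Variables (mu : Rd -> Rd) (sigma : Rd -> 'M[R]_d) (b : Rd -> Rd).
Hypotheses (hmu : Cb_infty_vec mu) (hsigma : Cb_infty_mx sigma).
Hypothesis hb : forall x i, b x i 0 =
  - mu x i 0 + \sum_(j < d) partial j (fun y => diffusion sigma y i j) x.

Local Notation a i j := (fun y : Rd => diffusion sigma y i j).
Local Notation m i := (fun y : Rd => mu y i 0).

(** The image of the constant function 1 under A^*. *)
Definition zeroth_order (x : Rd) : R :=
  2^-1 * (\sum_(i < d) \sum_(j < d) partial i (partial j (a i j)) x) -
  \sum_(i < d) partial i (m i) x.

(** The choice of b makes the first-order coefficient, the sum over j of d_j a_ij minus mu_i minus
    b_i, vanish for every i. *)
Lemma F_opE phi x : F_op mu sigma b phi x = zeroth_order x * phi x.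
Proof.
rewrite /F_op /zeroth_order mulrBl -mulr_suml.
have -> : \sum_(i < d) b x i 0 * partial i phi x =
    \sum_(i < d) (\sum_(j < d) partial j (a i j) x) * partial i phi x -
    \sum_(i < d) mu x i 0 * partial i phi x.
  rewrite -sumrB; apply: eq_bigr => i _.
  by rewrite hb mulrDl mulNr addrC.
ring.
Qed.

Lemma G_opE tau phi x :
  G_op mu sigma tau b phi x = phi x + tau * (zeroth_order x * phi x).
Proof. by rewrite /G_op F_opE. Qed.

Lemma smooth_diffusion i j : smooth (a i j).
Proof.
have -> : a i j = fun y => \sum_(k < d) sigma y i k * sigma y j k.
  by apply/funext => y; rewrite !mxE; apply: eq_bigr => k _; rewrite mxE.
apply: uCb_infty_sum => k.
by apply: uCb_inftyM; apply: Cb_infty_uniform; exact: hsigma.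
Qed.

Lemma smooth_drift i : smooth (m i).
Proof. exact: Cb_infty_uniform. Qed.

Lemma smooth_zeroth_order : smooth zeroth_order.
Proof.
apply: uCb_inftyD.
  apply: uCb_inftyM; first exact: smooth_cst.
  apply: uCb_infty_sum => i; apply: uCb_infty_sum => j.
  do 2 apply: smooth_partial; exact: smooth_diffusion.
apply: uCb_inftyN; apply: uCb_infty_sum => i.
apply: smooth_partial; exact: smooth_drift.
Qed.

Lemma smooth_b i : smooth (fun x => b x i 0).
Proof.
have -> : (fun x => b x i 0) = (fun x =>
  - mu x i 0 + \sum_(j < d) partial j (a i j) x).
  by apply/funext => x; rewrite hb.
apply: uCb_inftyD; first by apply: uCb_inftyN; exact: smooth_drift.
apply: uCb_infty_sum => j; apply: smooth_partial; exact: smooth_diffusion.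
Qed.

(** Coefficients are frozen at [x] while derivatives are taken at [y]: the Gaussian expansion
    differentiates along the columns of sigma(x), which are constant directions. *)
Definition second_order (phi : Rd -> R) (x y : Rd) : R :=
  \sum_(k < d) dird (col k (sigma x)) (dird (col k (sigma x)) phi) y.

Lemma second_orderE phi x y : smooth phi -> second_order phi x y =
  \sum_(i < d) \sum_(j < d) diffusion sigma x i j * partial i (partial j phi) y.
Proof.
move=> sphi; rewrite /second_order.
transitivity (\sum_(k < d) \sum_(i < d) \sum_(j < d)
    sigma x i k * sigma x j k * partial i (partial j phi) y).
  apply: eq_bigr => k _; rewrite {1}/dird; apply: eq_bigr => i _.
  rewrite partial_dird// mulr_sumr; apply: eq_bigr => j _.
  by rewrite !mxE mulrA.
rewrite exchange_big; apply: eq_bigr => i _.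
rewrite exchange_big; apply: eq_bigr => j _.
rewrite mxE mulr_suml; apply: eq_bigr => k _.
by rewrite mxE.
Qed.

(** The Leibniz rule brings A^* to non-divergence form. The cross terms from the second derivatives
    add up to twice the divergence of a, halved by the factor 1/2; together with -mu they give
    exactly the drift b. Hence A^* is multiplication by c plus the generator of the diffusion that
    the Euler scheme follows. *)
Lemma AstarE phi x : smooth phi -> Astar mu sigma phi x =
  zeroth_order x * phi x + dird (b x) phi x + 2^-1 * second_order phi x x.
Proof.
move=> sp; rewrite second_orderE// /Astar /zeroth_order /dird.
have E1 i : partial i (fun y => mu y i 0 * phi y) x =
    partial i (m i) x * phi x + mu x i 0 * partial i phi x.
  by rewrite (partialM _ (smooth_drift i) sp).
(* The third term is written with [a j i], equal to [a i j] by symmetry, so that exchanging the two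
   sums turns it into a copy of the second. *)
have E2 i j : partial i (partial j (fun y => diffusion sigma y i j * phi y)) x =
    partial i (partial j (a i j)) x * phi x + partial j (a i j) x * partial i
      phi x
    + (partial i (a j i) x * partial j phi x
    + diffusion sigma x i j * partial i (partial j phi) x).
  have sa := smooth_diffusion i j.
  rewrite (partialM _ sa sp).
  rewrite (@partialD (fun y => partial j (a i j) y * phi y)
    (fun y => diffusion sigma y i j * partial j phi y)); last 2 first.
  - exact: uCb_inftyM (smooth_partial j sa) sp.
  - exact: uCb_inftyM sa (smooth_partial j sp).
  rewrite (partialM _ (smooth_partial j sa) sp).
  rewrite (partialM _ sa (smooth_partial j sp)).
  congr (_ + (partial i _ x * _ + _)); apply/funext => y.
  by rewrite !mxE; apply: eq_bigr => k _; rewrite !mxE mulrC.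
rewrite (eq_bigr (fun i => \sum_(j < d) _) (fun i _ =>
  eq_bigr _ (fun j _ => E2 i j))).
rewrite (eq_bigr _ (fun i _ => E1 i)) big_split/=.
rewrite (eq_bigr _ (fun i _ => big_split _ _ _ _ _)) big_split/=.
rewrite !(eq_bigr _ (fun i _ => big_split _ _ _ _ _)) !big_split/=.
have E3 : \sum_(i < d) \sum_(j < d) partial i (a j i) x * partial j phi x =
    \sum_(i < d) \sum_(j < d) partial j (a i j) x * partial i phi x.
  by rewrite exchange_big.
rewrite E3.
have -> : \sum_(i < d) b x i 0 * partial i phi x =
    \sum_(i < d) \sum_(j < d) partial j (a i j) x * partial i phi x -
    \sum_(i < d) mu x i 0 * partial i phi x.
  rewrite -sumrB; apply: eq_bigr => i _.
  by rewrite hb mulrDl mulNr addrC mulr_suml.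
have -> : \sum_(i < d) \sum_(j < d) partial i (partial j (a i j)) x * phi x =
  (\sum_(i < d) \sum_(j < d) partial i (partial j (a i j)) x) * phi x.
  by rewrite mulr_suml; apply: eq_bigr => i _; rewrite mulr_suml.
have -> : \sum_(i < d) partial i (m i) x * phi x =
  (\sum_(i < d) partial i (m i) x) * phi x by rewrite mulr_suml.
by field.
Qed.

End operators.

(** * One step of the scheme: expansion, stability, continuity *)

Section scheme_step.
Context {R : realType} {d : nat}.
Local Notation Rd := 'cV[R]_d.
Variables (mu : Rd -> Rd) (sigma : Rd -> 'M[R]_d) (b : Rd -> Rd).
Hypotheses (hmu : Cb_infty_vec mu) (hsigma : Cb_infty_mx sigma).
Hypothesis hb : forall x i, b x i 0 =
  - mu x i 0 + \sum_(j < d) partial j (fun y => diffusion sigma y i j) x.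

Definition euler_mean (tau : R) (phi : Rd -> R) (x : Rd) : R :=
  \int[gauss_cV d tau]_w phi (x + tau *: b x + sigma x *m w).

Definition scheme_step (tau : R) (phi : Rd -> R) : Rd -> R :=
  euler_mean tau (G_op mu sigma tau b phi).

Lemma finite_family_bound (J : finType) (T : Type) (f : J -> T -> R) :
  (forall j, exists M, forall x, `|f j x| <= M) ->
  exists M, forall x j, `|f j x| <= M.
Proof.
move=> /choice[M fM]; exists (\sum_j `|M j|) => x j.
apply: le_trans (fM j x) _; apply: le_trans (ler_norm _) _.
by rewrite (bigD1 j)//= lerDl sumr_ge0.
Qed.

Lemma bounded_b : bounded_vectors b.
Proof.
apply: (finite_family_bound (f := fun i x => b x i 0)) => i.
have [M _ HM] := uCb_infty_bounded (smooth_b hmu hsigma hb i).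
by exists M => x; exact: (HM tt).
Qed.

Lemma bounded_sigma_col j : bounded_vectors (fun x => col j (sigma x)).
Proof.
apply: (finite_family_bound (f := fun i x => col j (sigma x) i 0)) => i.
have [_ _ [M HM]] := hsigma i j [::].
by exists M => x; rewrite mxE; exact: HM.
Qed.

Lemma measurable_euler_map (tau : R) (x : Rd) (g : Rd -> R) : continuous g ->
  measurable_fun setT (fun w : Rd => g (x + tau *: b x + sigma x *m w)).
Proof.
move=> cg; apply: measurableT_comp; last exact: measurable_affine.
exact: continuous_measurable_cV.
Qed.

Lemma integrable_euler_map (tau : R) (x : Rd) (g : Rd -> R) (M : R) :
  continuous g -> (forall y, `|g y| <= M) -> (gauss_cV d tau).-integrable setT
    (EFin \o (fun w => g (x + tau *: b x + sigma x *m w))).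
Proof.
move=> cg gM.
apply: (integrable_bounded_mass1 (gauss_mass1 d tau) _ (fun w => gM _)).
exact: measurable_euler_map.
Qed.

Lemma euler_mean_bound (tau : R) (x : Rd) (g : Rd -> R) (M : R) :
  continuous g -> (forall y, `|g y| <= M) -> `|euler_mean tau g x| <= M.
Proof.
move=> cg gM.
apply: (Rintegral_mass1_bound (gauss_mass1 d tau) _ (fun w => gM _)).
exact: measurable_euler_map.
Qed.

Section expansion.
Context {I : Type}.
Variable f : I -> Rd -> R.
Hypothesis uf : uCb_infty f.

Definition frozen_generator (g : Rd -> R) (x : Rd) : R :=
  dird (b x) g x + 2^-1 * second_order sigma g x x.

Let J := (I * Rd)%type.
Let fJ (k : J) := f k.1.
Let ufJ : uCb_infty fJ. Proof. exact: (uCb_infty_comp fst uf). Qed.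
Let bJ : bounded_vectors (fun k : J => b k.2).
Proof. by have [M bM] := bounded_b; exists M => k i; exact: bM. Qed.
Let sJ j : bounded_vectors (fun k : J => col j (sigma k.2)).
Proof. by have [M sM] := bounded_sigma_col j; exists M => k i; exact: sM. Qed.
Let L (k : J) y := second_order sigma (f k.1) k.2 y.
Let uL : uCb_infty L.
Proof. by apply: uCb_infty_sum => j; do 2 apply: uCb_infty_dird => //. Qed.

Lemma frozen_generator_bounded : exists2 C : R, 0 <= C &
  forall k x, `|frozen_generator (f k) x| <= C.
Proof.
have [C1 C10 H1] := uCb_infty_bounded (uCb_infty_dird bJ ufJ).
have [C2 C20 H2] := uCb_infty_bounded uL.
exists (C1 + 2^-1 * C2) => [|k x]; first
  by rewrite addr_ge0 ?mulr_ge0 ?invr_ge0.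
apply: le_trans (ler_normD _ _) _; rewrite lerD//; first exact: (H1 (k, x)).
by rewrite normrM ger0_norm ?invr_ge0// ler_wpM2l ?invr_ge0//;
  exact: (H2 (k, x)).
Qed.

(** Three errors: the Gaussian expansion around the shifted point x + t b(x), the first-order
    expansion of f in the drift, and the return of the second-order term from x + t b(x) to x, which
    costs O(t) and carries a factor t/2. *)
Lemma euler_mean_taylor : exists2 C : R, 0 <= C &
  forall k x (t : R), 0 < t -> t <= 1 ->
    `|euler_mean t (f k) x - f k x - t * frozen_generator (f k) x| <= C * t ^+
      2.
Proof.
have [C1 C10 H1] := gauss_taylor (V := fun k : J => sigma k.2) ufJ sJ.
have [C2 C20 H2] := uniform_taylor1 ufJ bJ.
have [C3 C30 H3] := uniform_taylor0 uL bJ.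
exists (C1 + C2 + C3) => [|k x t t0 t1]; first by rewrite !addr_ge0.
have := H1 (k, x) (x + t *: b x) t t0 t1.
have := H2 (k, x) x t; have := H3 (k, x) x t.
rewrite /fJ /= -/(euler_mean t (f k) x).
rewrite -/(second_order sigma (f k) x (x + t *: b x)) -/(L (k, x) (x + t *: b
  x)).
rewrite /frozen_generator -/(L (k, x) x).
set a := euler_mean _ _ _; set u := f k _; set g := L (k, x) (x + _).
set l := L (k, x) x; set D := dird _ _ _; set f0 := f k x.
clear -t0 t1 C10 C20 C30.
rewrite (ger0_norm (ltW t0)) => E3 E2 E1.
have -> : a - f0 - t * (D + 2^-1 * l) = (a - u - t / 2 * g) +
  (u - f0 - t * D) + t / 2 * (g - l) by field.
apply: le_trans (ler_normD _ _) _; rewrite mulrDl lerD//.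
  by apply: le_trans (ler_normD _ _) _; rewrite mulrDl lerD.
rewrite normrM ger0_norm ?divr_ge0 ?(ltW t0)//.
apply: (@le_trans _ _ (t * (C3 * t))); last by rewrite expr2 mulrCA.
apply: ler_pM => //; first by rewrite divr_ge0// ltW.
by rewrite ler_pdivrMr// ler_peMr ?(ltW t0)// ler1n.
Qed.

End expansion.

Lemma euler_mean_lin (tau c : R) (f g : Rd -> R) (Mf Mg : R) x :
  continuous f -> continuous g ->
  (forall y, `|f y| <= Mf) -> (forall y, `|g y| <= Mg) ->
  euler_mean tau (fun y => f y + c * g y) x =
  euler_mean tau f x + c * euler_mean tau g x.
Proof.
move=> cf cg fM gM.
have jf := integrable_euler_map tau x cf fM.
have jg := integrable_euler_map tau x cg gM.
have jcg := integrableZl measurableT c jg.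
by rewrite /euler_mean RintegralD// RintegralZl.
Qed.

(** By linearity S_t f = E f + t E(c f), where E is the Euler mean. The first mean is expanded to
    O(t^2), the second only has to be known to O(t), and [AstarE] recognizes the sum of the
    first-order terms. *)
Lemma scheme_step_consistent (I : Type) (f : I -> Rd -> R) : uCb_infty f ->
  exists2 C : R, 0 <= C & forall k x (t : R), 0 < t -> t <= 1 ->
    `|scheme_step t (f k) x - f k x - t * Astar mu sigma (f k) x| <= C * t ^+ 2.
Proof.
move=> uf.
pose c := zeroth_order mu sigma.
have sc : smooth c by exact: smooth_zeroth_order.
have ucf : uCb_infty (fun k y => c y * f k y).
  by apply: uCb_inftyM uf; exact: family_smooth.
have [C1 C10 H1] := euler_mean_taylor uf.
have [C2 C20 H2] := euler_mean_taylor ucf.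
have [C3 C30 H3] := frozen_generator_bounded ucf.
have [Mf _ fM] := uCb_infty_bounded uf.
have [Mg _ gM] := uCb_infty_bounded ucf.
exists (C1 + (C2 + C3)) => [|k x t t0 t1]; first by rewrite !addr_ge0.
have cf : continuous (f k) by exact: smooth_continuous (smooth_family k uf).
have cg : continuous (fun y => c y * f k y).
  exact: smooth_continuous (smooth_family k ucf).
have -> : scheme_step t (f k) x =
    euler_mean t (f k) x + t * euler_mean t (fun y => c y * f k y) x.
  rewrite -(euler_mean_lin _ _ _ cf cg (fM k) (gM k)) /scheme_step.
  by congr (euler_mean _ _ _); apply/funext => y; rewrite (G_opE hb).
have -> : Astar mu sigma (f k) x = c x * f k x + frozen_generator (f k) x.
  by rewrite (AstarE hmu hsigma hb _ (smooth_family k uf)) -addrA.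
have := H1 k x t t0 t1; have := H2 k x t t0 t1; have := H3 k x.
set A := euler_mean t (f k) x; set B := euler_mean t _ _; set f0 := f k x.
set g := frozen_generator (f k) x; set c0 := c x.
set L := frozen_generator _ _.
clearbody A B f0 g c0 L; clear -t0 t1 C10 C20 C30 => E3 E2 E1.
have -> : A + t * B - f0 - t * (c0 * f0 + g) =
  (A - f0 - t * g) + t * ((B - c0 * f0 - t * L) + t * L) by ring.
apply: le_trans (ler_normD _ _) _; rewrite mulrDl lerD//.
rewrite normrM (ger0_norm (ltW t0)).
apply: (@le_trans _ _ (t * ((C2 + C3) * t))); last by rewrite expr2 mulrCA.
rewrite ler_wpM2l ?(ltW t0)//.
apply: le_trans (ler_normD _ _) _; rewrite mulrDl lerD//.
  apply: le_trans E2 _; rewrite ler_wpM2l// expr2.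
  by rewrite ler_piMr// ltW.
by rewrite normrM (ger0_norm (ltW t0)) mulrC ler_wpM2r// ltW.
Qed.

Lemma G_op_continuous_bounded (t : R) (f : Rd -> R) (M : R) :
  continuous f -> (forall x, `|f x| <= M) ->
  continuous (G_op mu sigma t b f) /\
  exists M', forall x, `|G_op mu sigma t b f x| <= M'.
Proof.
move=> cf fM; pose c := zeroth_order mu sigma.
have sc : smooth c by exact: smooth_zeroth_order.
have -> : G_op mu sigma t b f = fun y => f y + t * (c y * f y).
  by apply/funext => y; rewrite (G_opE hb).
split.
  have cc : continuous c by exact: smooth_continuous.
  by move=> x; exact: cvgD (cf x) (cvgMl_tmp (cvgM (cc x) (cf x))).
have [K _ cK] := uCb_infty_bounded sc.
exists (M + `|t| * (K * M)) => x.
apply: le_trans (ler_normD _ _) _; rewrite lerD// !normrM ler_wpM2l//.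
by rewrite ler_pM//; exact: (cK tt).
Qed.

(** The factor 1 + t c is at most 1 + K t in absolute value, and averaging against a law of mass one
    does not increase the sup norm. *)
Lemma scheme_step_stable : exists2 K : R, 0 <= K &
  forall (t e Mf Mg : R) (f g : Rd -> R), 0 < t -> continuous f ->
    continuous g ->
    (forall y, `|f y| <= Mf) -> (forall y, `|g y| <= Mg) ->
    (forall y, `|f y - g y| <= e) ->
    forall x, `|scheme_step t f x - scheme_step t g x| <= (1 + K * t) * e.
Proof.
pose c := zeroth_order mu sigma.
have sc : smooth c by exact: smooth_zeroth_order.
have [K K0 cK] := uCb_infty_bounded sc.
exists K => // t e Mf Mg f g t0 cf cg fM gM fge x.
have [cGf [Nf Gf]] := G_op_continuous_bounded t cf fM.
have [cGg [Ng Gg]] := G_op_continuous_bounded t cg gM.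
apply: (Rintegral_mass1_dist (gauss_mass1 d t)
  (integrable_euler_map t x cGf Gf) (integrable_euler_map t x cGg Gg)) => w.
move: (_ + _ *m w) => y; rewrite !(G_opE hb) -/c.
have -> : f y + t * (c y * f y) - (g y + t * (c y * g y)) =
  (1 + c y * t) * (f y - g y) by ring.
rewrite normrM; apply: ler_pM => //.
apply: le_trans (ler_normD _ _) _;
  rewrite normr1 lerD// normrM (ger0_norm (ltW t0)).
by rewrite ler_wpM2r ?(ltW t0)//; exact: (cK tt).
Qed.

Lemma euler_map_cvg (F : set_system Rd) (FF : Filter F) (tau : R) (x w : Rd) :
  F --> x -> y + tau *: b y + sigma y *m w @[y --> F] -->
    x + tau *: b x + sigma x *m w.
Proof.
move=> Fx; apply: cvg_coord => i.
have -> : (fun y => (y + tau *: b y + sigma y *m w) i 0) =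
    (fun y => y i 0 + tau * b y i 0 + \sum_j sigma y i j * w j 0).
  by apply/funext => y; rewrite !mxE.
rewrite !mxE; apply: cvgD; first apply: cvgD.
- exact: cvg_comp Fx (@coord_continuous _ _ _ i 0 x).
- apply: cvgMl_tmp.
  exact: cvg_comp Fx (smooth_continuous (smooth_b hmu hsigma hb i) (x := x)).
- elim: (index_enum _) => [|j s IH].
    rewrite big_nil; have -> : (fun y =>
      \sum_(j <- [::]) sigma y i j * w j 0) = fun=> 0.
      by apply/funext => y; rewrite big_nil.
    exact: cvg_cst.
  rewrite big_cons; have -> : (fun y =>
    \sum_(j <- j :: s) sigma y i j * w j 0) =
      fun y => sigma y i j * w j 0 + \sum_(j <- s) sigma y i j * w j 0.
    by apply/funext => y; rewrite big_cons.
  apply: cvgD IH; apply: cvgMr_tmp.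
  have [_ cs _] := hsigma i j [::].
  exact: cvg_comp Fx (cs x).
Qed.

(** Dominated convergence speaks about sequences; this converts its conclusion into continuity. A
    failure of continuity would supply points u(n) within 1/(n+1) of x whose values stay away from
    f(x). *)
Lemma sequential_continuity (f : Rd -> R) (x : Rd) :
  (forall u : nat -> Rd, u @ \oo --> x -> f (u n) @[n --> \oo] --> f x) ->
  f y @[y --> x] --> f x.
Proof.
move=> seqf; have FF : Filter (nbhs x) by exact: nbhs_filter.
apply/(@cvgrPdist_le _ _ _ (nbhs x) FF) => e e0; apply: contrapT => nfx.
have /choice[u Hu] : forall n : nat, exists y, ball x n.+1%:R^-1 y /\
    e < `|f x - f y|.
  move=> n; apply: contrapT => H; apply: nfx.
  apply/nbhs_ballP; exists n.+1%:R^-1 => /=; first by rewrite invr_gt0.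
  move=> y xy /=; rewrite leNgt; apply/negP => fxy.
  by apply: H; exists y.
have ux : u @ \oo --> x.
  apply/cvg_ballP => r r0; near=> n.
  have [xu _] := Hu n; apply: le_ball xu.
  by apply: ltW; near: n; exact: (near_infty_natSinv_lt (PosNum r0)).
have /cvgrPdist_le/(_ _ e0)[N _ /(_ N)] := seqf u ux.
move=> /(_ (leqnn N)); rewrite leNgt => /negP; apply.
by have [] := Hu N.
Unshelve. all: by end_near. Qed.

(** Dominated convergence with the constant M. Continuity is what admits the conditional mean as a
    competitor in the minimization over continuous functions. *)
Lemma euler_mean_continuous (tau : R) (g : Rd -> R) (M : R) : continuous g ->
  (forall y, `|g y| <= M) -> continuous (euler_mean tau g).
Proof.
move=> cg gM x; apply: sequential_continuity => u ux.
rewrite /euler_mean /Rintegral; apply: fine_cvg.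
rewrite fineK; last first.
  exact: (@integrable_fin_num _ _ _ _ _ measurableT _
    (integrable_euler_map tau x cg gM)).
apply: (@dominated_cvg _ _ _ (gauss_cV d tau) _ measurableT
  (fun n w => (g (u n + tau *: b (u n) + sigma (u n) *m w))%:E) _
    (cst M%:E)) => //.
- by move=> n; apply/measurable_EFinP; exact: measurable_euler_map.
- move=> w _; apply: cvg_EFin; first exact: nearW.
  apply: (cvg_comp _ g); last exact: cg.
  exact: (@euler_map_cvg (u @ \oo) _ tau x w ux).
- apply: (integrable_bounded_mass1 (gauss_mass1 d tau) (M := `|M|)) => //.
- by move=> n w _; rewrite /= lee_fin.
Qed.

Lemma scheme_step_continuous_bounded (t : R) (f : Rd -> R) (M : R) :
  continuous f -> (forall x, `|f x| <= M) ->
  continuous (scheme_step t f) /\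
    exists M', forall x, `|scheme_step t f x| <= M'.
Proof.
move=> cf fM; have [cG [M' GM']] := G_op_continuous_bounded t cf fM.
split; first exact: euler_mean_continuous GM'.
by exists M' => x; exact: euler_mean_bound.
Qed.

End scheme_step.

(** * Time regularity of solutions *)

Section fokker_planck_regularity.
Context {R : realType} {d : nat}.
Local Notation Rd := 'cV[R]_d.
Variables (T : R) (mu : Rd -> Rd) (sigma : Rd -> 'M[R]_d) (b : Rd -> Rd).
Hypotheses (hmu : Cb_infty_vec mu) (hsigma : Cb_infty_mx sigma).
Hypothesis hb : forall x i, b x i 0 =
  - mu x i 0 + \sum_(j < d) partial j (fun y => diffusion sigma y i j) x.
Variables (q0 : Rd -> R) (p : R -> Rd -> R).
Hypotheses (hp : Cb_1_infty T p) (hFP : fokker_planck mu sigma T q0 p).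

Local Notation time := {t : R | t \in `[0, T]}.
Local Notation lebesgue := (@lebesgue_measure R).

Lemma strip_continuous_space (q : R -> Rd -> R) t :
  cont_bounded_on_strip T q -> t \in `[0, T] -> continuous (q t).
Proof.
move=> [/subspace_continuousP cq _] tT x.
have := cq (t, x) (conj tT Logic.I).
apply: (cvg_comp (fun y => (t, y)) (fun z : R * Rd => q z.1 z.2)).
move=> A [[B1 B2] [/= n1 n2] sub].
apply: (filterS _ n2) => y B2y.
by apply: (sub (t, y)) => //=; split=> //; exact: nbhs_singleton n1.
Qed.

Lemma strip_continuous_time (q : R -> Rd -> R) x :
  cont_bounded_on_strip T q -> {within `[0, T], continuous (q ^~ x)}.
Proof.
move=> [/subspace_continuousP cq _]; apply/subspace_continuousP => t tT.
have := cq (t, x) (conj tT Logic.I).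
apply: (cvg_comp (fun r => (r, x)) (fun z : R * Rd => q z.1 z.2)).
move=> A [[B1 B2] [/= n1 n2] sub].
apply: (filterS _ n1) => r B1r rT.
by apply: (sub (r, x)) => //=; split=> //; exact: nbhs_singleton n2.
Qed.

(** The bounds in [Cb_1_infty] hold on the whole strip, hence jointly for all times: the slices form
    a family indexed by time. *)
Lemma uniform_solution : uCb_infty (fun k : time => p (sval k)).
Proof.
move=> n; suff : forall s, uCb n (fun k : time => partials s (p (sval k))).
  exact: (fun H => H [::]).
have [_ hp2] := hp.
elim: n => [|n IH] s; have [ds [cs [M bs]]] := hp2 s; split.
- by move=> [t tT] x i; exact: ds.
- by move=> [t tT]; exact: strip_continuous_space (conj cs (ex_intro _
  M bs)) tT.
- by exists M => -[t tT] x; exact: bs.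
- exact: Logic.I.
- by move=> [t tT] x i; exact: ds.
- by move=> [t tT]; exact: strip_continuous_space (conj cs (ex_intro _
  M bs)) tT.
- by exists M => -[t tT] x; exact: bs.
- by move=> i; exact: (IH (i :: s)).
Qed.

Lemma smooth_solution t : t \in `[0, T] -> smooth (p t).
Proof. by move=> tT; exact: (smooth_family (exist _
  t tT) uniform_solution). Qed.

Let Lp r x := Astar mu sigma (p r) x.

Let LpE r x : r \in `[0, T] -> Lp r x = zeroth_order mu sigma x * p r x +
  \sum_(i < d) b x i 0 * partial i (p r) x +
  2^-1 * \sum_(i < d) \sum_(j < d)
    diffusion sigma x i j * partial i (partial j (p r)) x.
Proof.
move=> rT; have sp := smooth_solution rT.
by rewrite /Lp (AstarE hmu hsigma hb _ sp) second_orderE.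
Qed.

Lemma uniform_Astar_solution :
  uCb_infty (fun k : time => Astar mu sigma (p (sval k))).
Proof.
have -> : (fun k : time => Astar mu sigma (p (sval k))) = (fun k x =>
  zeroth_order mu sigma x * p (sval k) x +
  \sum_(i < d) b x i 0 * partial i (p (sval k)) x +
  2^-1 * \sum_(i < d) \sum_(j < d)
    diffusion sigma x i j * partial i (partial j (p (sval k))) x).
  by apply/funext => -[t tT]; apply/funext => x; exact: LpE.
have up := uniform_solution.
apply: uCb_inftyD; first apply: uCb_inftyD.
- by apply: uCb_inftyM => //;
  exact: family_smooth (smooth_zeroth_order hmu hsigma).
- apply: uCb_infty_sum => i; apply: uCb_inftyM.
    exact: family_smooth (smooth_b hmu hsigma hb i).
  exact: uCb_infty_partial.
apply: uCb_inftyM; first exact: family_smooth (smooth_cst _).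
apply: uCb_infty_sum => i; apply: uCb_infty_sum => j; apply: uCb_inftyM.
  exact: family_smooth (smooth_diffusion hsigma i j).
by apply: uCb_infty_partial; exact: uCb_infty_partial.
Qed.

(** Continuity in time is given for the derivatives of p alone, whereas A^* differentiates products
    with the coefficients; hence the passage through the expanded form [LpE]. *)
Let cLp x : {within `[0, T], continuous (Lp ^~ x)}.
Proof.
have [_ hp2] := hp.
have c0 : {within `[0, T], continuous (fun r => p r x)}.
  exact: (@strip_continuous_time (fun r => partials [::] (p r)) x (hp2 [::]).2).
have c1 i : {within `[0, T], continuous (fun r => partial i (p r) x)}.
  exact: (@strip_continuous_time (fun r =>
    partials [:: i] (p r)) x (hp2 [:: i]).2).
have c2 i j : {within `[0, T], continuous (fun r =>
  partial i (partial j (p r)) x)}.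
  exact: (@strip_continuous_time (fun r => partials [:: i;
    j] (p r)) x (hp2 [:: i; j]).2).
have cM a (g : R -> R) : {within `[0, T], continuous g} ->
    {within `[0, T], continuous (fun r => a * g r)}.
  by move=> cg r; apply: cvgMl_tmp; exact: cg.
have cD (g h : R -> R) : {within `[0, T], continuous g} ->
    {within `[0, T], continuous h} ->
    {within `[0, T], continuous (fun r => g r + h r)}.
  by move=> cg ch r; apply: cvgD; [exact: cg|exact: ch].
have cS (J : Type) (s : seq J) (g : J -> R -> R) :
    (forall j, {within `[0, T], continuous (g j)}) ->
    {within `[0, T], continuous (fun r => \sum_(j <- s) g j r)}.
  move=> cg; elim: s => [|j s IH].
    have -> : (fun r : R => \sum_(j <- [::]) g j r) = fun=> 0.
      by apply/funext => r; rewrite big_nil.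
    by move=> r; exact: cvg_cst.
  have -> : (fun r : R => \sum_(j <- j :: s) g j r) =
      fun r => g j r + \sum_(j <- s) g j r.
    by apply/funext => r; rewrite big_cons.
  exact: cD.
apply: (@subspace_eq_continuous _ _ _ (fun r =>
  zeroth_order mu sigma x * p r x +
  \sum_(i < d) b x i 0 * partial i (p r) x +
  2^-1 * \sum_(i < d) \sum_(j < d)
    diffusion sigma x i j * partial i (partial j (p r)) x)).
  by move=> r /set_mem rT; exact/esym/LpE.
apply: (@cD); first apply: (@cD); first exact: cM.
  by apply: cS => i; exact: cM.
by apply: (@cM); apply: (@cS) => i; apply: (@cS) => j; exact: cM.
Qed.

Let iLp x (J : interval R) : {subset J <= `[0, T]} ->
  lebesgue.-integrable [set` J] (EFin \o Lp ^~ x).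
Proof.
move=> JT.
have i0 : lebesgue.-integrable `[0, T] (EFin \o Lp ^~ x).
  by apply: continuous_compact_integrable; [exact: segment_compact|exact: cLp].
by apply: integrableS i0 => // r; exact: JT.
Qed.

Let subset_time (s t : R) : 0 <= s -> t <= T -> {subset `]s, t] <= `[0, T]}.
Proof. by move=> s0 tT; apply: subitvP; rewrite subitvE !bnd_simp s0 tT. Qed.

Let solution_increment x s t : 0 <= s -> s <= t -> t <= T ->
  p t x - p s x = \int[lebesgue]_(r in `]s, t]) Lp r x.
Proof.
move=> s0 st tT.
have sI : s \in `[0, T] by rewrite in_itv/= s0 (le_trans st).
have tI : t \in `[0, T] by rewrite in_itv/= tT (le_trans s0).
rewrite (hFP x tI) (hFP x sI).
rewrite -(@Rintegral_itvB _ (Lp ^~ x) (BLeft 0) (BRight t) s)//; last first.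
  by apply: iLp; apply: subitvP; rewrite subitvE !bnd_simp.
rewrite /Lp; ring.
Qed.

Lemma Rintegral_itv_dist (w : R -> R) (c K s t : R) : s <= t ->
  lebesgue.-integrable `]s, t] (EFin \o w) ->
  (forall r, r \in `]s, t] -> `|w r - c| <= K) ->
  `|\int[lebesgue]_(r in `]s, t]) w r - c * (t - s)| <= K * (t - s).
Proof.
move=> st iw wc.
have m : fine (lebesgue `]s, t]) = t - s.
  rewrite lebesgue_measure_itv/= lte_fin; case: ltP => // ts.
  by apply/esym/eqP; rewrite subr_eq0 eq_le ts st.
have ic a : lebesgue.-integrable `]s, t] (EFin \o (fun=> a : R)).
  apply: measurable_bounded_integrable => //.
    by rewrite /= lebesgue_measure_itv/=; case: ifP => _; rewrite -?EFinB ltry.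
  by exists `|a|; split; [exact: num_real|move=> x ax y _; exact: ltW].
have mI : measurable (`]s, t]%classic : set (measurableTypeR R)).
  exact: measurable_itv.
rewrite -m -!(Rintegral_cst lebesgue)// -RintegralB//.
have iwc := integrableB mI iw (ic c).
apply: le_trans (le_normr_Rintegral _ iwc) _ => //.
by apply: le_Rintegral => //; exact: integrable_norm iwc.
Qed.

(* Linear combinations over finitely many points encode the difference
   quotients that control the spatial derivatives of [p t - p s]. *)
Let combination_bound (l : seq (R * Rd)) (K s t : R) :
  0 <= s -> s <= t -> t <= T ->
  (forall r, r \in `[0, T] -> `|\sum_(a <- l) a.1 * Lp r a.2| <= K) ->
  `|\sum_(a <- l) a.1 * (p t a.2 - p s a.2)| <= K * (t - s).
Proof.
move=> s0 st tT lK.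
have mI : measurable (`]s, t]%classic : set (measurableTypeR R)).
  exact: measurable_itv.
have [il El] : lebesgue.-integrable `]s, t]
      (EFin \o (fun r => \sum_(a <- l) a.1 * Lp r a.2)) /\
    \int[lebesgue]_(r in `]s, t]) (\sum_(a <- l) a.1 * Lp r a.2) =
    \sum_(a <- l) a.1 * (p t a.2 - p s a.2).
  elim: l {lK} => [|a l [IH1 IH2]].
    have -> : (fun r : R => \sum_(a <- [::]) a.1 * Lp r a.2) = fun=> 0.
      by apply/funext => r; rewrite big_nil.
    by split; [exact: integrable0|rewrite big_nil Rintegral_cst// mul0r].
  have ia := integrableZl mI a.1 (iLp a.2 (subset_time s0 tT)).
  have ial := integrableD mI ia IH1.
  split.
    by apply: eq_integrable ial => // r _ /=; rewrite big_cons.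
  rewrite big_cons -IH2 solution_increment// -RintegralZl//; last first.
    exact: iLp (subset_time s0 tT).
  rewrite -RintegralD//.
  by apply: eq_Rintegral => r _; rewrite big_cons.
have := Rintegral_itv_dist (c := 0) (K := K) st il.
rewrite mul0r subr0 El; apply => r rst; rewrite subr0; apply: lK.
exact: subset_time rst.
Qed.


Let LpM2 : exists2 M : R, 0 <= M & forall r, r \in `[0, T] -> forall x,
  [/\ `|Lp r x| <= M, forall j, `|partial j (Lp r) x| <= M &
      forall i j, `|partial i (partial j (Lp r)) x| <= M].
Proof.
have uL := uniform_Astar_solution.
have [M0 M00 H0] := uCb_infty_bounded uL.
have [M1 M1P] : exists M, forall (k : time * Rd) j,
    `|partial j (Lp (sval k.1)) k.2| <= M.
  apply: finite_family_bound => j.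
  have [M _ HM] := uCb_infty_bounded (uCb_infty_partial j uL).
  by exists M => k; exact: HM.
have [M2 M2P] : exists M, forall (k : time * Rd) (ij : 'I_d * 'I_d),
    `|partial ij.1 (partial ij.2 (Lp (sval k.1))) k.2| <= M.
  apply: finite_family_bound => -[i j].
  have [M _ HM] := uCb_infty_bounded
    (uCb_infty_partial i (uCb_infty_partial j uL)).
  by exists M => k; exact: HM.
exists (M0 + `|M1| + `|M2|) => [|r rT x]; first by rewrite !addr_ge0.
pose k : time := exist _ r rT.
split=> [|j|i j].
- by apply: le_trans (H0 k x) _; rewrite -addrA lerDl addr_ge0.
- apply: le_trans (M1P (k, x) j) _; apply: le_trans (ler_norm _) _.
  by rewrite -addrA addrCA lerDl addr_ge0.
- apply: le_trans (M2P (k, x) (i, j)) _; apply: le_trans (ler_norm _) _.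
  by rewrite lerDr addr_ge0.
Qed.

(** Transfers a bound on increments of f - g, proportional to the step, to the derivatives. Applied
    with f = p(t) and g = p(s), it requires no derivative of p in time. *)
Lemma derive_quotient_bound (f g : Rd -> R) (v x : Rd) (K : R) :
  derivable f x v -> derivable g x v ->
  (forall h : R, `|f (x + h *: v) - f x - (g (x + h *: v) - g x)| <= K * `|h|)
    ->
  `|'D_v f x - 'D_v g x| <= K.
Proof.
move=> df dg fgK.
apply: (cvgr_to_le (cvg_norm (cvgB df dg))); near=> h.
have h0 : h != 0 by near: h; exact: nbhs_dnbhs_neq.
rewrite -[X in `|X| <= _]/(h^-1 *: (f (h *: v + x) - f x) -
  h^-1 *: (g (h *: v + x) - g x)).
rewrite ![h *: v + x]addrC -scalerBr normrZ normfV.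
by rewrite ler_pdivrMl ?normr_gt0// mulrC.
Unshelve. all: by end_near. Qed.

Let solution_smooth_at t x i : t \in `[0, T] -> derivable (p t) x (basis_vec i).
Proof. by move=> tT; exact: smooth_derivable (smooth_solution tT). Qed.

Let Lp_smooth r : r \in `[0, T] -> smooth (Lp r).
Proof.
by move=> rT; exact: (smooth_family (exist _ r rT) uniform_Astar_solution).
Qed.

Let shift_quotient (f : Rd -> R) (a x v : Rd) :
  (fun h : R => h^-1 *: (f (h *: v + x + a) - f (x + a))) =
  (fun h : R => h^-1 *: (f (h *: v + (x + a)) - f (x + a))).
Proof. by apply/funext => h; rewrite addrA. Qed.

Lemma partial_shift (f : Rd -> R) (a x : Rd) i :
  partial i (fun y => f (y + a)) x = partial i f (x + a).
Proof. by rewrite /partial /derive /= shift_quotient. Qed.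

Lemma derivable_shift (f : Rd -> R) (a x v : Rd) :
  derivable f (x + a) v -> derivable (fun y => f (y + a)) x v.
Proof. by rewrite /derivable /= shift_quotient. Qed.

(** A finite difference of p(t) - p(s) in space is the time integral of the same difference of A^*
    p, which the mean value theorem bounds by the step sizes. Dividing by the steps and letting them
    tend to 0 bounds the increments of the derivatives. *)
Let space_increments : exists2 M : R, 0 <= M & forall s t x,
  0 <= s -> s <= t -> t <= T ->
  [/\ `|p t x - p s x| <= M * (t - s),
      forall j, `|partial j (p t) x - partial j (p s) x| <= M * (t - s) &
      forall i j, `|partial i (partial j (p t)) x - partial i (partial j (p s))
        x|
        <= M * (t - s)].
Proof.
have [M M0 HM] := LpM2; exists M => // s t x s0 st tT.
have sI : s \in `[0, T] by rewrite in_itv/= s0 (le_trans st).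
have tI : t \in `[0, T] by rewrite in_itv/= tT (le_trans s0).
have st0 : 0 <= t - s by rewrite subr_ge0.
split=> [|j|i j].
- have := @combination_bound [:: (1, x)] M s t s0 st tT.
  rewrite big_seq1 mul1r; apply => r rT.
  by rewrite big_seq1 mul1r; case: (HM r rT x).
- apply: derive_quotient_bound => [||h]; [exact: solution_smooth_at..|].
  (* The first difference in direction j; for [Lp r] it is at most M |h|. *)
  have := @combination_bound [:: (1, x + h *: basis_vec j); (-1, x)]
    (M * `|h|) s t s0 st tT.
  rewrite !big_cons big_nil /= => H.
  have {H} : `|1 * (p t (x + h *: basis_vec j) - p s (x + h *: basis_vec j)) +
      (-1 * (p t x - p s x) + 0)| <= M * `|h| * (t - s).
    apply: H => r rT; rewrite !big_cons big_nil /= addr0 mul1r mulN1r.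
    have [c _ ->] := MVT_line (f := Lp r) x h
      (fun y => smooth_derivable (x := y) (i := j) (Lp_smooth rT)).
    rewrite normrM mulrC ler_wpM2r//.
    by have [_ + _] := HM r rT (x + c *: basis_vec j); apply.
  rewrite mulrAC; congr (`|_| <= _); ring.
have dp r y : r \in `[0, T] -> derivable (partial j (p r)) y (basis_vec i).
  by move=> rT; exact: smooth_derivable (smooth_partial j (smooth_solution rT)).
apply: derive_quotient_bound => [||h]; [exact: dp..|].
pose a := h *: basis_vec i : Rd.
pose u r y := p r (y + a) - p r y.
have du r y : r \in `[0, T] -> derivable (u r) y (basis_vec j).
  move=> rT; apply: derivableB; last exact: solution_smooth_at.
  by apply: derivable_shift; exact: solution_smooth_at.
have Du r : r \in `[0, T] ->
    partial j (p r) (x + a) - partial j (p r) x = 'D_(basis_vec j) (u r) x.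
  move=> rT; rewrite -partial_shift /partial /u.
  rewrite -[RHS]/('D_(basis_vec j) ((fun y => p r (y + a)) - p r) x).
  rewrite deriveB//; last exact: solution_smooth_at.
  by apply: derivable_shift; exact: solution_smooth_at.
rewrite !Du//.
apply: derive_quotient_bound => [||k]; [exact: du..|].
pose e := k *: basis_vec j : Rd.
(* The mixed second difference; two mean value steps bound it by M |h| |k| for [Lp r]. The inner
   quotient divides by k, the outer one by h. *)
have := @combination_bound [:: (1, x + e + a); (-1, x + e); (-1, x + a); (1, x)]
  (M * `|h| * `|k|) s t s0 st tT.
rewrite !big_cons big_nil /= => H.
have {H} : `|1 * (p t (x + e + a) - p s (x + e + a)) +
  (-1 * (p t (x + e) - p s (x + e)) + (-1 * (p t (x + a) - p s (x + a)) +
  (1 * (p t x - p s x) + 0)))| <= M * `|h| * `|k| * (t - s).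
  apply: H => r rT; rewrite !big_cons big_nil /=.
  pose w y := Lp r (y + a) - Lp r y.
  have sL := Lp_smooth rT.
  have dw y : derivable w y (basis_vec j).
    apply: derivableB; last exact: smooth_derivable sL.
    by apply: derivable_shift; exact: smooth_derivable sL.
  have [c _ E] := MVT_line x k dw.
  have -> : 1 * Lp r (x + e + a) + (-1 * Lp r (x + e) + (-1 * Lp r (x + a) +
      (1 * Lp r x + 0))) = w (x + e) - w x by rewrite /w; ring.
  rewrite E.
  have -> : 'D_(basis_vec j) w (x + c *: basis_vec j) =
      partial j (Lp r) (x + c *: basis_vec j + a) -
      partial j (Lp r) (x + c *: basis_vec j).
    rewrite -partial_shift /partial /w.
    rewrite -[LHS]/('D_(basis_vec j) ((fun y => Lp r (y + a)) - Lp r) _).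
    rewrite deriveB//; last exact: smooth_derivable sL.
    by apply: derivable_shift; exact: smooth_derivable sL.
  have [c' _ ->] := MVT_line (f := partial j (Lp r)) (x + c *: basis_vec j) h
    (fun y => smooth_derivable (x := y) (i := i) (smooth_partial j sL)).
  rewrite !normrM mulrC ler_wpM2r// mulrC ler_wpM2r//.
  by have [_ _] := HM r rT (x + c *: basis_vec j + c' *: basis_vec i); apply.
have -> : M * `|h| * `|k| * (t - s) = M * (t - s) * `|h| * `|k| by ring.
rewrite /u; congr (`|_| <= _); rewrite -/e; ring.
Qed.

Lemma sum_ord_le (n : nat) (F : 'I_n -> R) (c : R) :
  (forall i, F i <= c) -> \sum_(i < n) F i <= n%:R * c.
Proof.
move=> Fc; apply: (@le_trans _ _ (\sum_(i < n) c)); first exact: ler_sum.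
by rewrite sumr_const card_ord mulr_natl.
Qed.

(** The coefficients do not depend on time, so A^* p is Lipschitz in time because p and its space
    derivatives of order one and two are. Integrating the deviation from A^* p(s) over an interval
    of length t - s gains the second power. *)
Lemma solution_local_error : exists2 C : R, 0 <= C & forall x s t,
  0 <= s -> s <= t -> t <= T ->
  `|p t x - p s x - (t - s) * Astar mu sigma (p s) x| <= C * (t - s) ^+ 2.
Proof.
have aux (c x1 x2 y1 y2 z1 z2 : R) : c * x1 + y1 + 2^-1 * z1 -
    (c * x2 + y2 + 2^-1 * z2) = c * (x1 - x2) + (y1 - y2) + 2^-1 * (z1 - z2).
  by ring.
have [M M0 HM] := space_increments.
have bnd (f : Rd -> R) : smooth f -> exists B, forall x, `|f x| <= B.
  by move=> /uCb_infty_bounded[B _ fB]; exists B => x; exact: (fB tt).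
have [Bc cB] := bnd _ (smooth_zeroth_order hmu hsigma).
have [Bb bB] := finite_family_bound (f := fun i x => b x i 0)
  (fun i => bnd _ (smooth_b hmu hsigma hb i)).
have [Ba aB] := finite_family_bound (f := fun (ij : 'I_d * 'I_d) x =>
    diffusion sigma x ij.1 ij.2)
  (fun ij => bnd _ (smooth_diffusion hsigma ij.1 ij.2)).
(* Total size of the coefficients of A^* in expanded form: c, the d entries of b, and half of the
   d^2 entries of a. *)
pose B := `|Bc| + d%:R * `|Bb| + 2^-1 * (d%:R * (d%:R * `|Ba|)).
have B0 : 0 <= B by rewrite /B !addr_ge0 ?mulr_ge0 ?invr_ge0.
exists (B * M) => [|x s t s0 st tT]; first by rewrite mulr_ge0.
have sI : s \in `[0, T] by rewrite in_itv/= s0 (le_trans st).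
have st0 : 0 <= t - s by rewrite subr_ge0.
have LL r : s <= r -> r <= t -> `|Lp r x - Lp s x| <= B * M * (t - s).
  move=> sr rt.
  have rI : r \in `[0, T] by rewrite in_itv/= (le_trans s0)// (le_trans rt).
  have [H0 H1 H2] := HM s r x s0 sr (le_trans rt tT).
  have rsts : M * (r - s) <= M * (t - s) by rewrite ler_wpM2l// lerD2r.
  have {}H0 := le_trans H0 rsts.
  have {}H1 j := le_trans (H1 j) rsts.
  have {}H2 i j := le_trans (H2 i j) rsts.
  have Mts0 : 0 <= M * (t - s) by rewrite mulr_ge0.
  rewrite !LpE//.
  set c := zeroth_order _ _ _.
  have -> : c * p r x + \sum_(i < d) b x i 0 * partial i (p r) x +
      2^-1 * (\sum_(i < d) \sum_(j < d)
        diffusion sigma x i j * partial i (partial j (p r)) x) -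
    (c * p s x + \sum_(i < d) b x i 0 * partial i (p s) x +
      2^-1 * (\sum_(i < d) \sum_(j < d)
        diffusion sigma x i j * partial i (partial j (p s)) x)) =
    c * (p r x - p s x) +
    \sum_(i < d) b x i 0 * (partial i (p r) x - partial i (p s) x) +
    2^-1 * (\sum_(i < d) \sum_(j < d) diffusion sigma x i j *
      (partial i (partial j (p r)) x - partial i (partial j (p s)) x)).
    have -> : \sum_(i < d) b x i 0 * (partial i (p r) x - partial i (p s) x) =
        \sum_(i < d) b x i 0 * partial i (p r) x -
        \sum_(i < d) b x i 0 * partial i (p s) x.
      by rewrite -sumrB; apply: eq_bigr => i _; rewrite mulrBr.
    have -> : \sum_(i < d) \sum_(j < d) diffusion sigma x i j *
        (partial i (partial j (p r)) x - partial i (partial j (p s)) x) =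
      \sum_(i < d) \sum_(j < d)
        diffusion sigma x i j * partial i (partial j (p r)) x -
      \sum_(i < d) \sum_(j < d)
        diffusion sigma x i j * partial i (partial j (p s)) x.
      rewrite -sumrB; apply: eq_bigr => i _.
      by rewrite -sumrB; apply: eq_bigr => j _; rewrite mulrBr.
    exact: aux.
  rewrite [leRHS](_ : _ = `|Bc| * (M * (t - s)) + d%:R * `|Bb| * (M * (t - s))
    + 2^-1 * (d%:R * (d%:R * `|Ba|)) * (M * (t - s))); last first.
    by rewrite -mulrA /B 2!mulrDl.
  apply: le_trans (ler_normD _ _) _; apply: lerD.
    apply: le_trans (ler_normD _ _) _; apply: lerD.
      by rewrite normrM ler_pM// (le_trans (cB x))// ler_norm.
    apply: le_trans (ler_norm_sum _ _ _) _.
    rewrite -[leRHS]mulrA; apply: sum_ord_le => i.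
    by rewrite normrM ler_pM// (le_trans (bB x i))// ler_norm.
  rewrite normrM ger0_norm ?invr_ge0// -[leRHS]mulrA ler_wpM2l ?invr_ge0//.
  apply: le_trans (ler_norm_sum _ _ _) _.
  rewrite -[leRHS]mulrA; apply: sum_ord_le => i.
  apply: le_trans (ler_norm_sum _ _ _) _.
  rewrite -[leRHS]mulrA; apply: sum_ord_le => j.
  by rewrite normrM ler_pM// (le_trans (aB x (i, j)))// ler_norm.
rewrite solution_increment// -/(Lp s x) [_ * Lp s x]mulrC expr2 [leRHS]mulrA.
apply: Rintegral_itv_dist => //; first exact: iLp (subset_time s0 tT).
move=> r; rewrite in_itv/= => /andP[sr rt].
by apply: LL => //; exact: ltW.
Qed.

End fokker_planck_regularity.

(** * Convergence and uniqueness *)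

Section convergence.
Context {R : realType} {d : nat}.
Local Notation Rd := 'cV[R]_d.
Variables (T : R) (mu : Rd -> Rd) (sigma : Rd -> 'M[R]_d) (b : Rd -> Rd).
Hypothesis T0 : 0 < T.
Hypotheses (hmu : Cb_infty_vec mu) (hsigma : Cb_infty_mx sigma).
Hypothesis hb : forall x i, b x i 0 =
  - mu x i 0 + \sum_(j < d) partial j (fun y => diffusion sigma y i j) x.
Variable q0 : Rd -> R.
Hypothesis hq0 : Cb_infty q0.

Definition scheme_iter (tau : R) (n : nat) : Rd -> R :=
  iter n (scheme_step mu sigma b tau) q0.

Lemma scheme_iter_continuous_bounded tau n : continuous (scheme_iter tau n) /\
  exists M, forall x, `|scheme_iter tau n x| <= M.
Proof.
elim: n => [|n [cf [M fM]]]; first by have [_ cq bq] := hq0 [::].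
exact: (scheme_step_continuous_bounded hmu hsigma hb tau cf fM).
Qed.

Definition is_solution (p : R -> Rd -> R) : Prop :=
  Cb_1_infty T p /\ fokker_planck mu sigma T q0 p.

Lemma solution_initial p : is_solution p -> p 0 = q0.
Proof.
move=> [_ hFP]; apply/funext => x.
rewrite (hFP 0 x); last by rewrite in_itv/= lexx ltW.
by rewrite set_itv1 Rintegral_set1 addr0.
Qed.

(** The solution and the scheme both agree with p(s) + tau A^* p(s) up to O(tau^2). *)
Lemma scheme_step_local_error p : is_solution p -> exists2 C : R, 0 <= C &
  forall s tau x, 0 <= s -> 0 < tau -> tau <= 1 -> s + tau <= T ->
  `|p (s + tau) x - scheme_step mu sigma b tau (p s) x| <= C * tau ^+ 2.
Proof.
move=> [hp hFP].
have [C1 C10 H1] := solution_local_error hmu hsigma hb hp hFP.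
have [C2 C20 H2] := scheme_step_consistent hmu hsigma hb (uniform_solution hp).
exists (C1 + C2) => [|s tau x s0 tau0 tau1 sT]; first by rewrite addr_ge0.
have sI : s \in `[0, T] by rewrite in_itv/= s0 (le_trans _ sT)// lerDl ltW.
have := H2 (exist _ s sI) x tau tau0 tau1; rewrite /=.
have := H1 x s (s + tau) s0 _ sT; rewrite lerDl => /(_ (ltW tau0)).
rewrite [s + tau - s]addrC addKr.
set u := p (s + tau) x; set v := scheme_step _ _ _ _ _ _; set q := p s x.
set a := Astar _ _ _ _; clearbody u v q a; clear => E1 E2.
have -> : u - v = (u - q - tau * a) - (v - q - tau * a) by ring.
by apply: le_trans (ler_normB _ _) _; rewrite mulrDl lerD.
Qed.

Let split_error (u v w : R) : u - w = (v - w) + (u - v).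
Proof. by ring. Qed.

(** Induction step of a discrete Gronwall inequality: errors obeying e(m+1) <= (1 + k) e(m) + c from
    e(0) = 0 stay below m c (1 + k)^m. *)
Let recursion_bound (k c : R) (m : nat) : 0 <= c -> 0 <= k ->
  (1 + k) * (m%:R * c * (1 + k) ^+ m) + c <= m.+1%:R * c * (1 + k) ^+ m.+1.
Proof.
move=> c0 k0; have : 1 <= (1 + k) ^+ m by rewrite exprn_ege1// lerDl.
rewrite -natr1 exprS; move: (_ ^+ m) => X X1.
have : 0 <= c * ((1 + k) * X - 1).
  rewrite mulr_ge0// subr_ge0 -[1 in leLHS]mulr1 ler_pM//.
  by rewrite lerDl.
lra.
Qed.

(** Stability propagates the local errors to n C0 tau^2 (1 + K tau)^n. Since n tau <= T, this is at
    most C0 T exp(K T) tau, which is the constant chosen. It still depends on p through C0. *)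
Lemma scheme_converges p : is_solution p -> exists2 C : R, 0 <= C &
  forall (N n : nat) x, (0 < N)%N -> (n <= N)%N -> T / N%:R <= 1 ->
  `|p (tgrid T N n) x - scheme_iter (T / N%:R) n x| <= C * (T / N%:R).
Proof.
move=> sp; have [C0 C00 HC] := scheme_step_local_error sp.
have [K K0 HK] := scheme_step_stable hmu hsigma hb.
exists (C0 * T * expR (K * T)) => [|N n x N0 nN tau1].
  by rewrite !mulr_ge0 ?expR_ge0// ltW.
set tau := T / N%:R.
have tau0 : 0 < tau by rewrite divr_gt0// ltr0n.
have NT : N%:R * tau = T by rewrite /tau mulrCA divff ?mulr1// pnatr_eq0 -lt0n.
have grid m : (m <= N)%N -> 0 <= tgrid T N m <= T.
  move=> mN; rewrite /tgrid -/tau mulr_ge0 ?(ltW tau0)//=.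
  by rewrite -[leRHS]NT ler_wpM2r ?(ltW tau0)// ler_nat.
have E m y : (m <= N)%N -> `|p (tgrid T N m) y - scheme_iter tau m y| <=
    m%:R * (C0 * tau ^+ 2) * (1 + K * tau) ^+ m.
  elim: m y => [|m IH] y mN.
    by rewrite /tgrid !mul0r (solution_initial sp) subrr normr0.
  have gE : tgrid T N m.+1 = tgrid T N m + tau.
    by rewrite /tgrid -/tau -natr1 mulrDl mul1r.
  have mN' := ltnW mN; have /andP[g0 gT] := grid m mN'.
  have /andP[_ gT'] := grid _ mN; rewrite gE in gT' *.
  have tI : tgrid T N m \in `[0, T] by rewrite in_itv/= g0.
  have sm := smooth_solution sp.1 tI.
  have [Mp _ pM] := uCb_infty_bounded sm.
  have [cI [MI IM]] := scheme_iter_continuous_bounded tau m.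
  have S1 := HC _ _ y g0 tau0 tau1 gT'.
  have S2 := HK tau _ Mp MI _ _ tau0 (smooth_continuous sm) cI (pM tt) IM
    (fun y => IH y mN') y.
  rewrite /scheme_iter iterS -/(scheme_iter tau m).
  have -> : p (tgrid T N m + tau) y - scheme_step mu sigma b tau (scheme_iter
    tau m) y =
    (scheme_step mu sigma b tau (p (tgrid T N m)) y -
     scheme_step mu sigma b tau (scheme_iter tau m) y) +
    (p (tgrid T N m + tau) y - scheme_step mu sigma b tau (p (tgrid T N m)) y).
    exact: split_error.
  apply: le_trans (ler_normD _ _) _; apply: le_trans (lerD S2 S1) _.
  by apply: recursion_bound; rewrite mulr_ge0 ?sqr_ge0// ltW.
apply: le_trans (E n x nN) _.
have -> : C0 * T * expR (K * T) * tau = T * (C0 * tau) * expR (K * T) by ring.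
have nT : n%:R * tau <= T by rewrite -[leRHS]NT ler_wpM2r ?(ltW tau0)// ler_nat.
apply: ler_pM.
- by rewrite mulr_ge0// mulr_ge0// sqr_ge0.
- by rewrite exprn_ge0// addr_ge0// mulr_ge0// ltW.
- have -> : n%:R * (C0 * tau ^+ 2) = n%:R * tau * (C0 * tau) by ring.
  by rewrite ler_wpM2r// mulr_ge0// ltW.
rewrite -[K * T]mulrC.
apply: (@le_trans _ _ (expR (K * tau) ^+ n)).
  apply: lerXn2r; rewrite ?nnegrE ?expR_ge0 ?expR_ge1Dx//.
  by rewrite addr_ge0// mulr_ge0// ltW.
rewrite -expRM_natl ler_expR.
have : n%:R * tau * K <= T * K by rewrite ler_wpM2r.
by congr (_ <= _); ring.
Qed.

(** The time t_n of the grid with N steps is also a grid time for every multiple of N, and the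
    iterates of the scheme do not involve the solution: both solutions are limits of the same
    sequence. *)
Lemma solution_unique p p' N n x : is_solution p -> is_solution p' ->
  (0 < N)%N -> (n <= N)%N -> p (tgrid T N n) x = p' (tgrid T N n) x.
Proof.
move=> sp sp' N0 nN.
have [C C0 HC] := scheme_converges sp; have [C' C'0 HC'] :=
  scheme_converges sp'.
apply/eqP; rewrite -subr_eq0 -normr_le0; apply/ler_addgt0Pr => e e0.
rewrite add0r; apply: ltW.
(* The summand 1 keeps A positive. The refinement factor k+1 exceeds A / e, which makes the total
   error smaller than e, and exceeds T, which makes the refined step at most 1. *)
pose A := (C + C' + 1) * T.
have A0 : 0 < A by rewrite mulr_gt0// ltr_wpDl// addr_ge0.
pose k := (Num.bound (A / e) + Num.bound T)%N.
have k1 : A / e < k.+1%:R.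
  apply: lt_le_trans (archi_boundP _) _; first by rewrite divr_ge0 ?ltW.
  by rewrite ler_nat ltnW// ltnS leq_addr.
have k2 : T < k.+1%:R.
  apply: lt_le_trans (archi_boundP (ltW T0)) _.
  by rewrite ler_nat ltnW// ltnS leq_addl.
pose N' := (k.+1 * N)%N.
have N'0 : (0 < N')%N by rewrite muln_gt0.
have NR : 1 <= N%:R :> R by rewrite ler1n.
have kN : k.+1%:R <= N'%:R :> R by rewrite ler_nat leq_pmulr.
have gE : tgrid T N n = tgrid T N' (k.+1 * n).
  have k0 : k.+1%:R != 0 :> R by rewrite pnatr_eq0.
  have N0' : N%:R != 0 :> R by rewrite pnatr_eq0 -lt0n.
  by rewrite /tgrid /N' !natrM; move: k0 N0'; move: k.+1%:R N%:R => r s *;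
    field; apply/andP.
have nN' : (k.+1 * n <= N')%N by rewrite leq_pmul2l.
have tau1 : T / N'%:R <= 1.
  by rewrite ler_pdivrMr ?ltr0n// mul1r (le_trans (ltW k2)).
have H := HC _ _ x N'0 nN' tau1; have H' := HC' _ _ x N'0 nN' tau1.
rewrite gE -[X in `|X|](subrKA (scheme_iter (T / N'%:R) (k.+1 * n) x)).
apply: le_lt_trans (ler_normD _ _) _.
rewrite [X in _ + X]distrC; apply: le_lt_trans (lerD H H') _.
rewrite -mulrDl mulrA ltr_pdivrMr ?ltr0n//.
apply: (@le_lt_trans _ _ A); first by rewrite ler_wpM2r ?lerDl// ltW.
rewrite mulrC -ltr_pdivrMr//; exact: lt_le_trans k1 kN.
Qed.

End convergence.

(** * The minimization problem *)

Section quadratic_minimization.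
Context dX dE (TX : measurableType dX) (TE : measurableType dE) (R : realType).
Variables (muX : probability TX R).
Variable gam : {sigma_finite_measure set TE -> \bar R}.
Hypothesis gam1 : gam setT = 1%E.

(** Bias-variance decomposition: the cross term vanishes because m - G has mean zero. *)
Lemma Rintegral_sqr_dist (G : TE -> R) (M c : R) : measurable_fun setT G ->
  (forall w, `|G w| <= M) ->
  \int[gam]_w (c - G w) ^+ 2 =
  \int[gam]_w (\int[gam]_w' G w' - G w) ^+ 2 + (c - \int[gam]_w G w) ^+ 2.
Proof.
move=> mG GM; set m := \int[gam]_w G w.
have ib (h : TE -> R) B : measurable_fun setT h -> (forall w, `|h w| <= B) ->
    gam.-integrable setT (EFin \o h).
  by move=> mh; exact: integrable_bounded_mass1.
have iG := ib G M mG GM.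
have ic a : gam.-integrable setT (EFin \o (fun _ : TE => a : R)).
  by apply: (ib _ `|a|) => //; exact: measurable_cst.
have mD a : measurable_fun setT (fun w => a - G w).
  exact: measurable_funB.
have mD2 a : measurable_fun setT (fun w => (a - G w) ^+ 2).
  exact: measurable_funX.
have bD a w : `|a - G w| <= `|a| + M.
  by apply: le_trans (ler_normB _ _) _; rewrite lerD2l.
have iD2 a : gam.-integrable setT (EFin \o (fun w => (a - G w) ^+ 2)).
  apply: (ib _ ((`|a| + M) ^+ 2)) => // w.
  by rewrite normrX lerXn2r// nnegrE (le_trans _ (bD a w)).
have iD1 : gam.-integrable setT (EFin \o (fun w => m - G w)).
  by apply: (ib _ (`|m| + M)).
have cstE (a : R) : \int[gam]_w a = a.
  rewrite Rintegral_cst// -[RHS]mulr1; congr (_ * _); exact: (congr1 fine gam1).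
have E : \int[gam]_w (m - G w) = 0 by rewrite RintegralB// cstE subrr.
have iZ := integrableZl measurableT (2 * (c - m)) iD1.
have iS := integrableD measurableT (iD2 m) iZ.
transitivity (\int[gam]_w ((m - G w) ^+ 2 + 2 * (c - m) * (m - G w)
    + (c - m) ^+ 2)).
  by apply: eq_Rintegral => w _; ring.
rewrite RintegralD// RintegralD// RintegralZl// E mulr0 addr0.
by rewrite cstE.
Qed.

(* Tonelli reduces the loss to a fibrewise one, which the fibre mean
   minimizes; no integrability of the candidate [u] is needed. *)
Lemma fibre_mean_minimizes (u : TX -> R) (G : TX * TE -> R) (M : R) :
  measurable_fun setT u -> measurable_fun setT G -> (forall z, `|G z| <= M) ->
  let v x := \int[gam]_w G (x, w) in
  measurable_fun setT v ->
  (\int[muX \x gam]_z (`|v z.1 - G z| ^+ 2)%:E <=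
   \int[muX \x gam]_z (`|u z.1 - G z| ^+ 2)%:E)%E.
Proof.
move=> mmeas mG GM v mv.
have mH (h : TX -> R) : measurable_fun setT h ->
    measurable_fun setT (fun z : TX * TE => (`|h z.1 - G z| ^+ 2)%:E).
  move=> mh; apply/measurable_EFinP; apply: measurable_funX.
  apply: measurableT_comp => //; apply: measurable_funB => //.
  exact: measurableT_comp mh measurable_fst.
have H0 (h : TX -> R) z : (0 <= (`|h z.1 - G z| ^+ 2)%:E)%E.
  by rewrite lee_fin exprn_ge0.
rewrite !fubini_tonelli1//; [|exact: mH..].
have mF (h : TX -> R) (mh : measurable_fun setT h) :=
  @measurable_fun_fubini_tonelli_F _ _ _ _ _ gam _ (mH h mh) (H0 h).
apply: ge0_le_integral => //.
- by move=> x _; apply: integral_ge0 => w _; exact: (H0 v (x, w)).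
- exact: mF.
- exact: mF.
move=> x _; rewrite /fubini_F.
have mGx : measurable_fun setT (fun w => G (x, w)).
  exact: measurableT_comp mG (measurable_pair1 x).
have int_real (c : R) : (\int[gam]_w (`|c - G (x, w)| ^+ 2)%:E =
    (\int[gam]_w (c - G (x, w)) ^+ 2)%:E)%E.
  under eq_integral do rewrite real_normK ?num_real//.
  rewrite /Rintegral fineK//.
  apply: (@integrable_fin_num _ _ _ gam _ measurableT
    (EFin \o (fun w => (c - G (x, w)) ^+ 2))).
  apply: (integrable_bounded_mass1 gam1 (M := (`|c| + M) ^+ 2)).
    by apply: measurable_funX; exact: measurable_funB.
  move=> w; have bD : `|c - G (x, w)| <= `|c| + M.
    by apply: le_trans (ler_normB _ _) _; rewrite lerD2l.
  by rewrite normrX lerXn2r// nnegrE (le_trans _ bD).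
rewrite [leLHS](int_real (v x)) [leRHS](int_real (u x)) lee_fin.
rewrite [leRHS](Rintegral_sqr_dist (u x) mGx (fun w => GM (x, w))).
by rewrite lerDl sqr_ge0.
Qed.

End quadratic_minimization.

(** * The law of an Euler-Maruyama step and its quadratic loss *)

Section euler_maruyama.
Context {R : realType} {d : nat} {disp : measure_display}.
Context {Omega : measurableType disp}.
Local Notation Rd := 'cV[R]_d.
Variables (T : R) (mu : Rd -> Rd) (sigma : Rd -> 'M[R]_d) (b : Rd -> Rd).
Hypothesis T0 : 0 < T.
Hypotheses (hmu : Cb_infty_vec mu) (hsigma : Cb_infty_mx sigma).
Hypothesis hb : forall x i, b x i 0 =
  - mu x i 0 + \sum_(j < d) partial j (fun y => diffusion sigma y i j) x.
Variable P : probability Omega R.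
Variables (F : R -> set (set Omega)) (W : R -> Omega -> Rd) (Z0 : Omega -> Rd).
Hypotheses (hF : filtration T F) (hW : brownian_motion P T F W).
Hypothesis hZ0 : measurable_wrt (F 0) Z0.
Variable N : nat.
Hypothesis N0 : (0 < N)%N.

Local Notation tau := (T / N%:R).
Local Notation t := (tgrid T N).
Local Notation Z := (euler_maruyama b sigma t W Z0).

Let tau0 : 0 < tau. Proof. by rewrite divr_gt0// ltr0n. Qed.

Lemma tgrid_step n : t n.+1 - t n = tau.
Proof. by rewrite /tgrid -natr1; ring. Qed.

Lemma tgrid_itv n : (n <= N)%N -> t n \in `[0, T].
Proof.
move=> nN; rewrite in_itv/= /tgrid mulr_ge0 ?(ltW tau0)//=.
have {2}-> : T = N%:R * tau by rewrite mulrCA divff ?mulr1// pnatr_eq0 -lt0n.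
by rewrite ler_wpM2r ?(ltW tau0)// ler_nat.
Qed.

(** Moves measurability with respect to a sub-sigma-algebra into the type of the domain, where the
    general closure rules for measurable maps apply. *)
Lemma measurable_wrtP (G : set (set Omega)) (X : Omega -> Rd) :
  sigma_algebra setT G -> measurable_wrt G X <->
  measurable_fun setT (X : g_sigma_algebraType G -> Rd).
Proof.
move=> sG; split=> [mX _ B mB|mX B mB].
  by rewrite setTI measurable_g_measurableTypeE//; exact: mX.
by have := mX measurableT B mB; rewrite setTI measurable_g_measurableTypeE.
Qed.

Lemma measurable_b i : measurable_fun setT (fun x => b x i 0).
Proof.
by apply: continuous_measurable_cV;
  exact: smooth_continuous (smooth_b hmu hsigma hb i).
Qed.

Lemma measurable_sigma i j : measurable_fun setT (fun x => sigma x i j).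
Proof. by apply: continuous_measurable_cV; have [_] := hsigma i j [::]. Qed.

Lemma measurable_euler_update dS (S : measurableType dS) (X xi : S -> Rd) :
  measurable_fun setT X -> measurable_fun setT xi ->
  measurable_fun setT
    (fun w => X w + tau *: b (X w) + sigma (X w) *m xi w).
Proof.
move=> mX mxi; apply: measurable_fun_coordP => i.
under eq_fun do rewrite !mxE.
apply: measurable_funD; first apply: measurable_funD.
- exact: measurableT_comp (measurable_coord i) mX.
- apply: measurable_funM => //.
  exact: measurableT_comp (measurable_b i) mX.
- apply: measurable_sum => j; apply: measurable_funM.
    exact: measurableT_comp (measurable_sigma i j) mX.
  exact: measurableT_comp (measurable_coord j) mxi.
Qed.

(** Adaptedness places the events of Z_n in F(t_n), as the independence of the next Brownian
    increment demands. *)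
Lemma euler_maruyama_adapted n : (n <= N)%N -> measurable_wrt (F (t n)) (Z n).
Proof.
elim: n => [|n IH] nN; first by rewrite /tgrid mul0r.
have nN' := ltnW nN.
have sF := filtration_sigma_algebra hF (tgrid_itv nN).
have sub : F (t n) `<=` F (t n.+1).
  have := tgrid_itv nN; have := tgrid_itv nN'.
  rewrite !in_itv/= => /andP[t0 _] /andP[_ tT].
  apply: (filtration_nondecreasing hF) => //.
  by rewrite -subr_ge0 tgrid_step ltW.
have mono (X : Omega -> Rd) : measurable_wrt (F (t n)) X ->
    measurable_fun setT (X : g_sigma_algebraType (F (t n.+1)) -> Rd).
  by move=> mX; apply/measurable_wrtP => // B mB; apply: sub; exact: mX.
apply/(measurable_wrtP _ sF).
rewrite /= tgrid_step; apply: measurable_euler_update; first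
  exact: mono (IH nN').
have mW : measurable_fun setT (W (t n) : g_sigma_algebraType (F (t n.+1)) ->
  Rd).
  by apply: mono; exact: (brownian_adapted hW (tgrid_itv nN')).
have mW' : measurable_fun setT
    (W (t n.+1) : g_sigma_algebraType (F (t n.+1)) -> Rd).
  by apply/(measurable_wrtP _ sF); exact: (brownian_adapted hW (tgrid_itv nN)).
apply: measurable_fun_coordP => i; rewrite /increment.
under eq_fun do rewrite !mxE.
by apply: measurable_funB;
  [exact: measurableT_comp (measurable_coord i) mW'
  |exact: measurableT_comp (measurable_coord i) mW].
Qed.

Lemma measurable_of_wrt s (X : Omega -> Rd) : s \in `[0, T] ->
  measurable_wrt (F s) X -> measurable_fun setT X.
Proof.
by move=> sT mX _ B mB; rewrite setTI; apply: (filtration_measurable hF sT);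
  exact: mX.
Qed.

Section one_step.
Variable n : nat.
Hypothesis nN : (n < N)%N.

Let xi := increment W (t n) (t n.+1).

Let mZ : measurable_fun setT (Z n).
Proof.
by apply: measurable_of_wrt (tgrid_itv (ltnW nN)) _;
  exact: euler_maruyama_adapted (ltnW nN).
Qed.

Let mxi : measurable_fun setT xi.
Proof.
have mW := measurable_of_wrt (tgrid_itv (ltnW nN))
  (brownian_adapted hW (tgrid_itv (ltnW nN))).
have mW' := measurable_of_wrt (tgrid_itv nN) (brownian_adapted hW (tgrid_itv
  nN)).
apply: measurable_fun_coordP => i; rewrite /xi /increment.
under eq_fun do rewrite !mxE.
by apply: measurable_funB;
  [exact: measurableT_comp (measurable_coord i) mW'
  |exact: measurableT_comp (measurable_coord i) mW].
Qed.

Let Zn : {mfun Omega >-> Rd} := mfun_Sub (mem_set mZ).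

Let joint : Omega -> Rd * Rd := fun w => (Z n w, xi w).

Let mjoint : measurable_fun setT joint.
Proof. exact: measurable_fun_pair. Qed.

Let Zxi : {mfun Omega >-> (Rd * Rd)%type} := mfun_Sub (mem_set mjoint).

(** The increment is independent of F(t_n), to which the events of Z_n belong, so the joint law
    factorizes on rectangles, and these determine a product measure. The step is positive, so
    [gauss_cV] is the genuine Gaussian law. *)
Let law_joint A : measurable A ->
  (distribution P Zn \x gauss_cV d tau)%E A = distribution P Zxi A.
Proof.
move=> mA; apply: product_measure_unique => // B C mB mC.
have := tgrid_itv (ltnW nN); have := tgrid_itv nN.
rewrite !in_itv/= => /andP[_ tT] /andP[t0 _].
have tlt : t n < t n.+1 by rewrite -subr_gt0 tgrid_step.
have ZB := euler_maruyama_adapted (ltnW nN) mB.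
have := brownian_increment_indep hW t0 tlt tT ZB mC.
rewrite (brownian_increment_law hW t0 tlt tT mC) tgrid_step => <-.
by [].
Qed.

(** Transporting the expectation to the joint law separates Z_n from the noise, so that the loss can
    be minimized for each value of Z_n separately. *)
Lemma msq_loss_product (g u : Rd -> R) : continuous g -> continuous u ->
  msq_loss P (Z n) (Z n.+1) g u =
  (\int[distribution P Zn \x gauss_cV d tau]_z
    (`|u z.1 - g (z.1 + tau *: b z.1 + sigma z.1 *m z.2)| ^+ 2)%:E)%E.
Proof.
move=> cg cu; rewrite /msq_loss unlock.
have mH : measurable_fun setT (fun z : Rd * Rd =>
    (`|u z.1 - g (z.1 + tau *: b z.1 + sigma z.1 *m z.2)| ^+ 2)%:E).
  apply/measurable_EFinP; apply: measurable_funX.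
  apply: measurableT_comp => //; apply: measurable_funB.
    apply: measurableT_comp measurable_fst; exact: continuous_measurable_cV.
  apply: measurableT_comp; first exact: continuous_measurable_cV.
  exact: measurable_euler_update measurable_fst measurable_snd.
rewrite (eq_measure_integral (distribution P Zxi)); last first.
  by move=> A mA _; exact: law_joint.
rewrite (ge0_integral_distribution Zxi mH) => [|z]; last first.
  by rewrite lee_fin exprn_ge0.
by apply: eq_integral => w _; rewrite /= tgrid_step.
Qed.

Lemma euler_mean_minimizes (g u : Rd -> R) (M : R) : continuous g ->
  (forall y, `|g y| <= M) -> continuous u ->
  (msq_loss P (Z n) (Z n.+1) g (euler_mean sigma b tau g) <=
   msq_loss P (Z n) (Z n.+1) g u)%E.
Proof.
move=> cg gM cu.
have cv : continuous (euler_mean sigma b tau g).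
  exact: (euler_mean_continuous hmu hsigma hb cg gM).
rewrite !msq_loss_product//.
apply: (@fibre_mean_minimizes _ _ _ _ R (distribution P Zn) (gauss_cV d tau)
  (gauss_mass1 d tau) u
  (fun z : Rd * Rd => g (z.1 + tau *: b z.1 + sigma z.1 *m z.2)) M).
- exact: continuous_measurable_cV.
- apply: measurableT_comp; first exact: continuous_measurable_cV.
  exact: measurable_euler_update measurable_fst measurable_snd.
- by move=> z; exact: gM.
- exact: continuous_measurable_cV.
Qed.

End one_step.

End euler_maruyama.

Theorem theorem2p2
  (R : realType) (d : nat) (hd : (1 <= d)%N) (T : R) (hT : 0 < T)
  (mu : 'cV[R]_d -> 'cV[R]_d) (sigma : 'cV[R]_d -> 'M[R]_d)
  (q0 : 'cV[R]_d -> R)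
  (hmu : Cb_infty_vec mu) (hsigma : Cb_infty_mx sigma)
  (hq0 : Cb_infty q0) (hq0d : is_density q0)
  (hHor : parabolic_hormander mu sigma)
  (b : 'cV[R]_d -> 'cV[R]_d)
  (hb : forall x i, b x i 0 =
     - mu x i 0 + \sum_(j < d) partial j (fun y => diffusion sigma y i j) x) :
  exists C : R, 0 < C /\
    forall (N : nat) (hN : (1 <= N)%N)
      (p : R -> 'cV[R]_d -> R)
      (hp : Cb_1_infty T p) (hFP : fokker_planck mu sigma T q0 p)
      (disp : measure_display) (Omega : measurableType disp)
      (P : probability Omega R)
      (F : R -> set (set Omega)) (hF : filtration T F)
      (W : R -> Omega -> 'cV[R]_d) (hW : brownian_motion P T F W)
      (qt0 : 'cV[R]_d -> R)
      (hqt0 : is_density qt0) (hqt0m : finite_moments qt0)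
      (Z0 : Omega -> 'cV[R]_d)
      (hZ0F : measurable_wrt (F 0) Z0) (hZ0 : has_density P Z0 qt0)
      (opi : nat -> 'cV[R]_d -> R)
      (hopi : forall n, (n <= N)%N -> Cb_infty (opi n))
      (hopi0 : opi 0%N = q0),
    let tau := T / N%:R in
    let t := tgrid T N in
    let Z := euler_maruyama b sigma t W Z0 in
    (forall n, (n < N)%N ->
       argmin [set u : 'cV[R]_d -> R | continuous u]
              (msq_loss P (Z (N - n.+1)%N) (Z (N - n)%N)
                 (G_op mu sigma tau b (opi n)))
       = [set opi n.+1]) ->
    tau <= 1 ->
    (ereal_sup
       [set 'N[lebesgue_cV d]_+oo [EFin \o (p (t n) \- opi n)%R]
         | n in [set n : nat | (n <= N)%N]]
     <= (C * tau)%:E)%E.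
Proof.
have [C C0 HC] : exists2 C : R, 0 <= C & forall p, is_solution T mu sigma q0 p
  ->
    forall (N n : nat) x, (0 < N)%N -> (n <= N)%N -> T / N%:R <= 1 ->
    `|p (tgrid T N n) x - scheme_iter mu sigma b q0 (T / N%:R) n x|
    <= C * (T / N%:R).
  (* The constant is fixed before p. It is taken from one solution, if any exists, and uniqueness at
     the grid points carries the estimate to all others; without a solution the claim is vacuous. *)
  have [[p0 sp0]|nsol] := pselect (exists p0, is_solution T mu sigma q0 p0).
    have [C C0 HC] := scheme_converges hT hmu hsigma hb hq0 sp0.
    exists C => // p sp N n x N0 nN tau1.
    by rewrite (solution_unique hT hmu hsigma hb hq0 x sp sp0 N0 nN); exact: HC.
  by exists 0 => // p sp; exfalso; apply: nsol; exists p.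
(* C may be 0, while a positive constant is required. *)
exists (C + 1); split; first by rewrite ltr_wpDl.
move=> N N0 p hp hFP disp Omega P F hF W hW qt0 _ _ Z0 hZ0F _ opi hopi hopi0.
move=> tau t Z hargmin tau1.
have tau0 : 0 < tau by rewrite divr_gt0// ltr0n.
have opiE n : (n <= N)%N -> opi n = scheme_iter mu sigma b q0 tau n.
  elim: n => [//|n IH] nN; have nN' := ltnW nN.
  rewrite /scheme_iter iterS -/(scheme_iter mu sigma b q0 tau n) -IH//.
  have [_ copi [M opiM]] := hopi n nN' [::].
  have [cG [M' GM']] := G_op_continuous_bounded hmu hsigma hb tau copi opiM.
  (* The scheme runs backwards along the chain: the passage from opi_n to opi_(n+1) uses the Euler
     step from Z_(N-(n+1)) to its successor Z_(N-n). *)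
  have k1 : (N - n = (N - n.+1).+1)%N by rewrite subnSK.
  have kN : (N - n.+1 < N)%N by rewrite ltn_subrL N0.
  (* The set of minimizers is assumed to be a singleton, so one exhibited minimizer must be
     opi_(n+1). *)
  suff : argmin [set u : 'cV[R]_d -> R | continuous u]
      (msq_loss P (Z (N - n.+1)%N) (Z (N - n)%N)
        (G_op mu sigma tau b (opi n))) (scheme_step mu sigma b tau (opi n)).
    by rewrite hargmin// => ->.
  split; first exact: (scheme_step_continuous_bounded hmu hsigma hb tau copi
    opiM).1.
  move=> u cu; rewrite k1.
  exact: (euler_mean_minimizes hT hmu hsigma hb hF hW hZ0F N0 kN cG GM' cu).
apply: ge_ereal_sup => _ [n /= nN <-].
have pB x : `|p (t n) x - opi n x| <= (C + 1) * tau.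
  rewrite opiE//; apply: le_trans (HC p (conj hp hFP) N n x N0 nN tau1) _.
  by rewrite ler_wpM2r ?(ltW tau0)// lerDl.
(* The norm at [+oo] is defined by cases: its default value 0 satisfies the bound trivially, and the
   essential supremum is controlled by the estimate valid at every point. *)
rewrite unlock /Lnorm.body; case: ifPn => _; last first.
  by rewrite lee_fin mulr_ge0 ?(ltW tau0)// addr_ge0.
by apply/ess_supP; apply: nearW => x /=; rewrite lee_fin.
Qed.
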